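(* Let $D>0$ and $\sigma>0$. For every $r>0$, $$\int_{\mathbb{R}}\big(E_0^{(1;r)}\tau_a\big)\,\mu^{\mathrm{Gauss},1}_{\sigma^2}(da)=\frac1r\Big(2e^{\frac{r\sigma^2}{D}}\int_{-\sqrt{\frac{2r}{D}}\,\sigma}^\infty \frac{e^{-\frac{x^2}{2}}}{\sqrt{2\pi}}\,dx-1\Big).$$ Equivalently, writing $r=\frac{D}{\sigma^2}s$ with $s>0$, $$\int_{\mathbb{R}}\big(E_0^{(1;\frac{D}{\sigma^2}s)}\tau_a\big)\,\mu^{\mathrm{Gauss},1}_{\sigma^2}(da)=\frac{\sigma^2}{D}\left(\frac{2e^s\int_{-\sqrt{2s}}^\infty \frac{e^{-\frac{x^2}{2}}}{\sqrt{2\pi}}\,dx-1}{s}\right).$$ Moreover, $$\inf_{r>0}\int_{\mathbb{R}}\big(E_0^{(1;r)}\tau_a\big)\,\mu^{\mathrm{Gauss},1}_{\sigma^2}(da)\approx 3.548\,\frac{\sigma^2}{D},$$ with the infimum attained at $r\approx 0.491\,\frac{D}{\sigma^2}$.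
   Context: Fix a diffusion coefficient $D>0$. One-dimensional Brownian motion with diffusion coefficient $D$ is the diffusion with generator $\frac D2\frac{d^2}{dx^2}$ (variance $Dt$ at time $t$). Poissonian instantaneous reset search process in dimension 1 with rate $r>0$: the process $X^{(1;r)}(\cdot)$ starts from the origin and performs one-dimensional Brownian motion with diffusion coefficient $D$; independently, it is equipped with an exponential clock of rate $r$. When the clock rings, the position is instantaneously reset to the origin, and the process starts anew independently with the same rule (with a new independent exponential clock of rate $r$), and so on. $E_0^{(1;r)}$ denotes expectation for this process starting from $0$. For $a\in\mathbb{R}$, $\tau_a=\inf\{t\ge 0: X^{(1;r)}(t)=a\}$. $\mu^{\mathrm{Gauss},1}_{\sigma^2}$ is the centered Gaussian distribution on $\mathbb{R}$ with variance $\sigma^2$, i.e. with density $\frac{1}{\sqrt{2\pi}\,\sigma}e^{-\frac{a^2}{2\sigma^2}}$. The symbol $\approx$ denotes a decimal numerical approximation; no explicit error tolerance is specified. *)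

(* Defs.v *)
From HB Require Import structures.
From mathcomp Require Import all_boot all_order all_algebra finmap.
From mathcomp Require Import all_classical all_reals all_analysis.

Set Implicit Arguments.
Unset Strict Implicit.
Unset Printing Implicit Defensive.

Import Order.TTheory GRing.Theory Num.Theory.
Import numFieldNormedType.Exports.

Local Open Scope classical_set_scope.
Local Open Scope ring_scope.

Section reset_process.
Context d (Omega : measurableType d) (R : realType) (P : probability Omega R).

Definition mutually_independent (I : choiceType) (F : I -> set (set Omega)) :=
  forall (J : {fset I}) (A : I -> set Omega),
    (forall i, i \in J -> F i (A i)) ->
    P (\bigcap_(i in [set` J]) A i) = (\prod_(i <- J) P (A i))%E.

Definition sigma_of (Y : Omega -> R) : set (set Omega) :=
  preimage_set_system setT Y measurable.

Definition sigma_of_process (B : R -> Omega -> R) : set (set Omega) :=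
  <<s \bigcup_(t in `[0, +oo[) sigma_of (B t) >>.

(* Equality is required on measurable sets only: [mu] and [P] carry no
   information on the other ones. *)
Definition has_law (Y : Omega -> R) (mu : set R -> \bar R) :=
  forall U : set R, measurable U -> P (Y @^-1` U) = mu U.

(* Brownian motion with generator (D / 2) d^2/dx^2 started from the origin. Time
   is [0, +oo[; [B t] is irrelevant for t < 0. *)
Record brownian_motion (D : R) (B : R -> {RV P >-> R}) : Prop := {
  brownian_start : forall w, B 0 w = 0 ;
  brownian_continuous : forall w,
    {within `[0, +oo[, continuous (fun t : R => B t w)} ;
  brownian_increment : forall s t : R, 0 <= s -> s < t ->
    has_law (B t \- B s) (normal_prob 0 (Num.sqrt (D * (t - s)))) ;
  brownian_independent : forall t : nat -> R, 0 <= t 0%N ->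
    (forall n, t n <= t n.+1) ->
    mutually_independent (fun n => sigma_of (B (t n.+1) \- B (t n)))
}.

Definition reset_time (T : nat -> Omega -> R) (n : nat) (w : Omega) : R :=
  \sum_(k < n) T k w.

(* During the n-th cycle, [reset_time T n w <= t < reset_time T n.+1 w], the
   process follows the n-th path. Almost surely all the clocks are positive and
   the reset times tend to infinity, so that there is exactly one such n. *)
Definition reset_process (B : nat -> R -> Omega -> R) (T : nat -> Omega -> R)
    (t : R) (w : Omega) : R :=
  let n := xget 0%N
    [set n | reset_time T n w <= t < reset_time T n.+1 w] in
  B n (t - reset_time T n w) w.

Definition poisson_reset_process (D r : R) (X : R -> Omega -> R) : Prop :=
  exists (B : nat -> R -> {RV P >-> R}) (T : nat -> {RV P >-> R}),
    [/\ forall n, brownian_motion D (B n),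
        forall n, has_law (T n) (exponential_prob r),
        mutually_independent (fun i : nat + nat =>
          match i with
          | inl n => sigma_of_process (B n)
          | inr n => sigma_of (T n)
          end)
      & X = reset_process (fun n t => B n t) (fun n => T n)].

Definition hitting_time (X : R -> Omega -> R) (a : R) (w : Omega) : \bar R :=
  ereal_inf [set t%:E | t in [set t : R | 0 <= t /\ X t w = a]].

(* Not ['E_P[_]], which only accepts real-valued functions: a hitting time may
   be infinite. *)
Definition mean_hitting_time (X : R -> Omega -> R) (a : R) : \bar R :=
  (\int[P]_w hitting_time X a w)%E.

End reset_process.

Definition std_gauss_tail (R : realType) (c : R) : R :=
  \int[lebesgue_measure]_(x in `[c, +oo[)
    (expR (- (x ^+ 2 / 2)) / Num.sqrt (2 * pi)).

(* Main.v *)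
(* Fix a level a of sign e and put th = sqrt (2 r / D). For a dyadic sampling of a
   Brownian motion B, e B is a Gaussian random walk, and its exponential moments
   killed at the first passage above b > 0 give the discounted law of the passage
   time up to an overshoot that vanishes with the mesh. Hence the crossing time s
   of b satisfies E e^(-rs) = e^(-th b) =: q. A cycle of the reset process lasts
   min (s, T) with T exponential of rate r, has mean (1 - q) / r and succeeds with
   probability q; summing over the i.i.d. cycles gives E tau = (1/q - 1) / r =
   (e^(th b) - 1) / r. The hitting time of a lies between the crossing times of the
   levels b < |a| and |a|, so the mean hitting time of a is (e^(th |a|) - 1) / r,
   which is integrated against the Gaussian measure by completing the square.

   For the optimal rate, s = x^2 / 2 turns the sign of the derivative of
   (2 e^s Phi(sqrt (2 s)) - 1) / s into that of
   M(x) = (x^2 - 2) Phi(x) + (1 + x / sqrt (2 pi)) e^(- x^2 / 2), which is convex for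
   x >= 0. Its positive root is located by alternating Taylor bounds for e^(-y),
   for Phi and (to estimate pi) for cos. *)

Require Import Defs.
From HB Require Import structures.
From mathcomp Require Import all_boot all_order all_algebra finmap.
From mathcomp Require Import all_classical all_reals all_analysis.
From mathcomp Require Import measurable_realfun.
From mathcomp Require Import ring lra.

Set Implicit Arguments.
Unset Strict Implicit.
Unset Printing Implicit Defensive.

Import Order.TTheory GRing.Theory Num.Theory.
Import numFieldNormedType.Exports.

Local Open Scope classical_set_scope.
Local Open Scope ring_scope.

(** * Independence *)

(** The hitting time of a level is not shown to be measurable, nor is its mean as a function of the
    level, and this shapes the proof. Both are squeezed between integrals of measurable functions,
    since the integral of a nonnegative function is monotone without measurability. The measurable
    stand-in is the time of strict crossing, which depends only on the path at dyadic times. A path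
    could touch [a] without passing it at once, so the lower bound uses levels strictly below [|a|],
    and the gap closes by continuity in the level. Neither a strong Markov property nor a
    continuous-time martingale is invoked. Optional stopping becomes a telescoping sum for a killed
    walk with finitely many steps, and the overshoot is controlled by a second, larger exponent [l]:
    the mesh is refined until [l ^+ 2] times the variance of one step is at most 1, and only then
    does [l] grow. The level 0 is set aside: crossings are studied for positive levels only, and the
    Gaussian law does not charge it. *)

Section independence.
Context d (Omega : measurableType d) (R : realType) (P : probability Omega R).

Definition indep_sets (S1 S2 : set (set Omega)) :=
  forall A B, S1 A -> S2 B -> P (A `&` B) = (P A * P B)%E.

Lemma indep_setsC S1 S2 : indep_sets S1 S2 -> indep_sets S2 S1.
Proof. by move=> H A B SA SB; rewrite setIC H// muleC. Qed.

(** For fixed [B], the events satisfying the product formula form a Dynkin system, and the Dynkin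
    system generated by a pi-system is already a sigma-algebra. *)
Lemma indep_sets_salgebra (G S : set (set Omega)) :
  setI_closed G -> G `<=` measurable -> S `<=` measurable ->
  indep_sets G S -> indep_sets <<s G >> S.
Proof.
move=> GI Gm Sm GS A B sGA SB.
have mB := Sm _ SB.
suff : <<d G >> `<=` [set A | measurable A /\ P (A `&` B) = (P A * P B)%E].
  by rewrite setI_closed_g_dynkin_g_sigma_algebra// => /(_ _ sGA)[].
apply: smallest_sub => [|C GC]; last by split; [exact: Gm|exact: GS].
split.
- by split => //; rewrite setTI probability_setT mul1e.
- move=> C [mC PC]; split; first exact: measurableC.
  have PCB : P (C `&` B) \is a fin_num by rewrite fin_num_measure//; exact: measurableI.
  rewrite setIC -setDE measureD//; last by rewrite ltey_eq fin_num_measure.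
  rewrite (setIC B) probability_setC//.
  rewrite [X in (_ - X)%E](_ : _ = P C * P B)%E//.
  rewrite muleBl ?mul1e//; first by rewrite fin_num_measure.
- move=> F tF HF; have mF n : measurable (F n) by case: (HF n).
  split; first exact: bigcupT_measurable.
  rewrite setI_bigcupl measure_semi_bigcup//=; first last.
  + by apply: bigcup_measurable => n _; exact: measurableI.
  + by under eq_fun do rewrite setIC; exact: trivIset_setIl.
  + by move=> n; exact: measurableI.
  rewrite measure_semi_bigcup//=; last exact: bigcupT_measurable.
  under eq_eseriesr => n _ do rewrite (proj2 (HF n)) muleC.
  by rewrite -(fineK (fin_num_measure P _ mB)) nneseriesZl// muleC.
Qed.

Lemma indep_sets_salgebra2 (G1 G2 : set (set Omega)) :
  setI_closed G1 -> setI_closed G2 ->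
  G1 `<=` measurable -> G2 `<=` measurable ->
  indep_sets G1 G2 -> indep_sets <<s G1 >> <<s G2 >>.
Proof.
move=> I1 I2 m1 m2 H.
apply: indep_sets_salgebra => //.
  by apply: smallest_sub => //; exact: sigma_algebra_measurable.
by apply/indep_setsC/indep_sets_salgebra => //; exact/indep_setsC.
Qed.

(* The pi-system of finite intersections of members of [F i], [i \in K]. *)
Definition finite_intersections (I : choiceType) (F : I -> set (set Omega))
    (K : set I) : set (set Omega) :=
  [set C | exists (J : {fset I}) (A : I -> set Omega),
    [/\ [set` J] `<=` K, forall i, F i (A i) & C = \bigcap_(i in [set` J]) A i]].

Section grouping.
Context (I : choiceType) (F : I -> set (set Omega)).
Hypotheses (F_measurable : forall i, F i `<=` measurable)
  (FI : forall i, setI_closed (F i)) (FT : forall i, F i setT).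

Lemma finite_intersections_setI K : setI_closed (finite_intersections F K).
Proof.
move=> _ _ [J1 [A1 [J1K FA1 ->]]] [J2 [A2 [J2K FA2 ->]]].
pose A i := (if i \in J1 then A1 i else setT) `&` (if i \in J2 then A2 i else setT).
exists (J1 `|` J2)%fset, A; split.
- by move=> i /=; rewrite inE => /orP[/J1K|/J2K].
- by move=> i; apply: FI; case: ifP.
- apply/seteqP; split=> w.
    move=> [w1 w2] i /= _; split; case: ifPn => // iJ; [exact: w1|exact: w2].
  move=> H; split=> i /= iJ.
    by have := H i; rewrite /= inE iJ => /(_ isT)[]; rewrite iJ.
  by have := H i; rewrite /= inE iJ orbT => /(_ isT)[_]; rewrite iJ.
Qed.

Lemma finite_intersections_measurable K : finite_intersections F K `<=` measurable.
Proof.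
move=> _ [J [A [_ FA ->]]].
by apply: fin_bigcap_measurable => // i _; exact: F_measurable.
Qed.

Lemma finite_intersections_indep K1 K2 : K1 `&` K2 = set0 ->
  mutually_independent P F ->
  indep_sets (finite_intersections F K1) (finite_intersections F K2).
Proof.
move=> K12 PF _ _ [J1 [A1 [J1K FA1 ->]]] [J2 [A2 [J2K FA2 ->]]].
pose A i := if i \in J1 then A1 i else A2 i.
have FA i : F i (A i) by rewrite /A; case: ifP.
have dJ i : i \in J2 -> i \notin J1.
  move=> iJ2; apply/negP => iJ1.
  suff: set0 i by []. by rewrite -K12; split; [exact: J1K|exact: J2K].
rewrite PF; last by move=> i _.
rewrite PF; last by move=> i _.
have -> : \bigcap_(i in [set` J1]) A1 i `&` \bigcap_(i in [set` J2]) A2 i =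
    \bigcap_(i in [set` (J1 `|` J2)%fset]) A i.
  apply/seteqP; split=> w.
    move=> [w1 w2] i /=; rewrite /A inE.
    case: ifPn => [iJ1 _|iJ1 /= iJ2]; [exact: w1|exact: w2].
  move=> H; split=> i /= iJ.
    by have := H i; rewrite /= inE iJ /A iJ => /(_ isT).
  by have := H i; rewrite /= inE iJ orbT /A (negbTE (dJ _ iJ)) => /(_ isT).
rewrite PF// (big_fsetID _ (fun i => i \in J1))/=.
by congr (_ * _)%E; apply: eq_fbig => i; rewrite !inE /= /A;
  case: (boolP (i \in J1)) => iJ1; case: (boolP (i \in J2)) => iJ2 //=;
  rewrite ?(negbTE (dJ _ iJ2)) // ?iJ1 //; have := dJ _ iJ2; rewrite iJ1.
Qed.

(** This stands in for conditioning throughout: past increments against the next one, a path against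
    its clock, past cycles against the present one. *)
Lemma mutually_independent_grouping K1 K2 : K1 `&` K2 = set0 ->
  mutually_independent P F ->
  indep_sets <<s \bigcup_(i in K1) F i >> <<s \bigcup_(i in K2) F i >>.
Proof.
move=> K12 PF.
have sub K : <<s \bigcup_(i in K) F i >> `<=` <<s finite_intersections F K >>.
  apply: smallest_sub; first exact: smallest_sigma_algebra.
  move=> C [i Ki FiC]; apply: sub_gen_smallest.
  exists [fset i]%fset, (fun j => if j == i then C else setT); split.
  - by move=> j /=; rewrite inE => /eqP ->.
  - by move=> j; case: eqP => [->|].
  - apply/seteqP; split=> w /=.
      by move=> Cw j /=; rewrite inE => /eqP ->; rewrite eqxx.
    by move=> /(_ i); rewrite /= inE eqxx; apply.
move=> A B /sub sA /sub sB.
have := indep_sets_salgebra2 (finite_intersections_setI (K:=K1))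
  (finite_intersections_setI (K:=K2)) (@finite_intersections_measurable K1)
  (@finite_intersections_measurable K2) (finite_intersections_indep K12 PF).
exact.
Qed.

End grouping.

(** The joint law is the product of the two laws, by uniqueness on rectangles, and Tonelli applies.
    The inner integral freezes [f w], which amounts to conditioning on [f]. *)
Lemma ge0_integral_indep_RV d1 d2 (T1 : measurableType d1)
    (T2 : measurableType d2) (f : {RV P >-> T1}) (g : {RV P >-> T2})
    (h : T1 * T2 -> \bar R) :
  measurable_fun setT h -> (forall z, (0 <= h z)%E) ->
  (forall U V, measurable U -> measurable V ->
    P (f @^-1` U `&` g @^-1` V) = (P (f @^-1` U) * P (g @^-1` V))%E) ->
  (\int[P]_w h (f w, g w) = \int[P]_w \int[P]_v h (f w, g v))%E.
Proof.
move=> mh h0 fg.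
have mfg : measurable_fun setT (fun w => (f w, g w)).
  by apply: measurable_fun_pair; exact: measurable_funP.
pose fg_ : {RV P >-> (T1 * T2)%type} := mfun_Sub (mem_set mfg).
transitivity (\int[distribution P fg_]_z h z)%E.
  by rewrite ge0_integral_distribution.
rewrite (eq_measure_integral (distribution P f \x distribution P g)%E); last first.
  move=> A mA _; exact/esym/product_measure_unique.
rewrite fubini_tonelli1//.
rewrite ge0_integral_distribution//; first last.
- by move=> x; apply: integral_ge0.
- exact: measurable_fun_fubini_tonelli_F.
apply: eq_integral => w _ /=; rewrite /fubini_F ge0_integral_distribution//.
exact: measurableT_comp.
Qed.

Lemma ge0_integral_indep d1 d2 (T1 : measurableType d1) (T2 : measurableType d2)
    (f : Omega -> T1) (g : Omega -> T2) (h : T1 * T2 -> \bar R) :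
  measurable_fun setT f -> measurable_fun setT g ->
  measurable_fun setT h -> (forall z, (0 <= h z)%E) ->
  (forall U V, measurable U -> measurable V ->
    P (f @^-1` U `&` g @^-1` V) = (P (f @^-1` U) * P (g @^-1` V))%E) ->
  (\int[P]_w h (f w, g w) = \int[P]_w \int[P]_v h (f w, g v))%E.
Proof.
move=> mf mg.
exact: (@ge0_integral_indep_RV _ _ _ _ (mfun_Sub (mem_set mf))
  (mfun_Sub (mem_set mg))).
Qed.

Lemma ge0_integralM_indep (f g : Omega -> \bar R) :
  measurable_fun setT f -> measurable_fun setT g ->
  (forall w, (0 <= f w)%E) -> (forall w, (0 <= g w)%E) ->
  (forall U V, measurable U -> measurable V ->
    P (f @^-1` U `&` g @^-1` V) = (P (f @^-1` U) * P (g @^-1` V))%E) ->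
  (\int[P]_w (f w * g w) = \int[P]_w f w * \int[P]_w g w)%E.
Proof.
move=> mf mg f0 g0 fg.
(* Absolute values make the integrand nonnegative on all pairs of extended reals; they disappear
   because [f] and [g] are nonnegative. *)
have mh : measurable_fun setT (fun z : \bar R * \bar R => `|z.1| * `|z.2|)%E.
  by apply: emeasurable_funM; apply: measurableT_comp.
have /= := @ge0_integral_indep _ _ _ _ f g _ mf mg mh.
under eq_integral do rewrite !gee0_abs//.
move=> ->//.
rewrite -ge0_integralZr//; last exact: integral_ge0.
by apply: eq_integral => w _; under eq_integral do rewrite !gee0_abs//;
  rewrite ge0_integralZl.
Qed.

End independence.

(** * Integrals against a density, and monotonicity of the integral *)

Section density.
Import HBNNSimple.

(** Both sides are limits along the same increasing simple functions, and on an indicator the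
    identity is the hypothesis on [nu]. *)
Lemma ge0_integral_density d (T : measurableType d) (R : realType)
    (mu nu : {measure set T -> \bar R}) (p : T -> R) (f : T -> \bar R) :
  measurable_fun setT p -> (forall x, 0 <= p x) ->
  (forall A, measurable A -> nu A = \int[mu]_(x in A) (p x)%:E)%E ->
  measurable_fun setT f -> (forall x, (0 <= f x)%E) ->
  (\int[nu]_x f x = \int[mu]_x (f x * (p x)%:E))%E.
Proof.
move=> mp p0 nuE mf f0.
pose f_ := nnsfun_approx measurableT mf.
have f_f x : (f_ n x)%:E @[n --> \oo] --> f x by exact: cvg_nnsfun_approx.
have ndf x m n : (m <= n)%N -> ((f_ m x)%:E <= (f_ n x)%:E)%E.
  by move=> mn; rewrite lee_fin; exact/lefP/nd_nnsfun_approx.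
have -> : (\int[nu]_x f x = limn (fun n => \int[nu]_x (f_ n x)%:E))%E.
  rewrite -monotone_convergence//.
  - by apply: eq_integral => x _; apply/esym/cvg_lim.
  - by move=> n; exact/measurable_EFinP/measurable_funP.
  - by move=> n x _; rewrite lee_fin.
  - by move=> x _ m n; exact: ndf.
have mpE : measurable_fun setT (EFin \o p) by exact/measurable_EFinP.
have -> : (\int[mu]_x (f x * (p x)%:E) =
    limn (fun n => \int[mu]_x ((f_ n x)%:E * (p x)%:E)))%E.
  rewrite -monotone_convergence//.
  - apply: eq_integral => x _; apply/esym/cvg_lim => //.
    by apply: cvgeZr => //; exact: f_f.
  - move=> n; apply: emeasurable_funM => //.
    exact/measurable_EFinP/measurable_funP.
  - by move=> n x _; rewrite mule_ge0// lee_fin.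
  - by move=> x _ m n mn; rewrite lee_wpmul2r ?lee_fin//; exact: ndf.
congr (limn _); apply/funext => n; set h := f_ n.
have mh y : measurable (h @^-1` [set y]) by exact: measurable_funPTI.
have hE x : (h x)%:E = (\sum_(y \in range h) y%:E * (\1_(h @^-1` [set y]) x)%:E)%E.
  by rewrite fsumEFin //= fimfunE.
have y1 y x : (0 <= y%:E * (\1_(h @^-1` [set y]) x)%:E)%E.
  exact: nnfun_muleindic_ge0.
have m1 y : measurable_fun setT (fun x => y%:E * (\1_(h @^-1` [set y]) x)%:E)%E.
  by apply: measurable_funeM; exact/measurable_EFinP/measurable_indic.
under eq_integral do rewrite hE.
rewrite ge0_integral_fsum//.
have -> : (\int[mu]_x ((h x)%:E * (p x)%:E) = \int[mu]_x
    \sum_(y \in range h) (y%:E * (\1_(h @^-1` [set y]) x)%:E * (p x)%:E))%E.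
  apply: eq_integral => x _; rewrite hE ge0_mule_fsuml//.
rewrite ge0_integral_fsum//; first last.
- by move=> y x _; rewrite mule_ge0// lee_fin.
- by move=> y; exact: emeasurable_funM.
apply: eq_fsbigr => y; rewrite inE => -[x _ <-{y}].
set y := h x.
have y0 : 0 <= y by rewrite /y.
have mi : measurable_fun setT (fun x : T => (\1_(h @^-1` [set y]) x)%:E : \bar R).
  exact/measurable_EFinP/measurable_indic.
rewrite ge0_integralZl//.
under [RHS]eq_integral do rewrite -muleA.
rewrite ge0_integralZl//.
- rewrite integral_indic// setIT nuE//; congr (_ * _)%E.
  rewrite integral_mkcond; apply: eq_integral => z _.
  by rewrite epatch_indic muleC.
- exact: emeasurable_funM.
- by move=> z _; rewrite mule_ge0// lee_fin.
Qed.

(* The integral of a nonnegative function is a supremum over the simple functions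
   below it: it is monotone even on nonmeasurable functions. *)
Lemma ge0_le_integral_sup d (T : measurableType d) (R : realType)
    (mu : {measure set T -> \bar R}) (f g : T -> \bar R) :
  (forall x, (0 <= f x)%E) -> (forall x, (f x <= g x)%E) ->
  (\int[mu]_x f x <= \int[mu]_x g x)%E.
Proof.
move=> f0 fg; have g0 x : (0 <= g x)%E by exact: le_trans (fg x).
rewrite !ge0_integralTE//; apply: ereal_sup_le => _ [h /= hf <-].
by exists h => // x; exact: le_trans (fg x).
Qed.

End density.

(** * Gaussian and exponential integrals *)

Lemma ge0_integral_has_law d (Omega : measurableType d) (R : realType)
    (P : probability Omega R) (Y : Omega -> R) (mu : {measure set (measurableTypeR R) -> \bar R})
    (f : R -> \bar R) :
  measurable_fun setT Y ->
  has_law P Y mu -> measurable_fun setT f -> (forall x, (0 <= f x)%E) ->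
  (\int[P]_w f (Y w) = \int[mu]_x f x)%E.
Proof.
move=> mY Ymu mf f0.
have mY' : measurable_fun setT (Y : Omega -> measurableTypeR R) by exact: mY.
pose Y' : {RV P >-> (measurableTypeR R)} :=
  @mfun_Sub _ _ Omega (measurableTypeR R) Y (mem_set mY').
transitivity (\int[distribution P Y']_x f x)%E.
  by rewrite ge0_integral_distribution.
by apply: eq_measure_integral => A mA _; exact: Ymu.
Qed.

Section gaussian_integrals.
Context {R : realType}.
Implicit Types (m s c x : R).
Local Notation mu := (@lebesgue_measure R).

Lemma ge0_integral_normal_prob m s (f : R -> \bar R) :
  measurable_fun setT f -> (forall x, (0 <= f x)%E) ->
  (\int[normal_prob m s]_x f x = \int[mu]_x (f x * (normal_pdf m s x)%:E))%E.
Proof.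
move=> mf f0; apply: ge0_integral_density => //.
- exact: measurable_normal_pdf.
- by move=> x; exact: normal_pdf_ge0.
Qed.

(** Exponential tilting of a centred Gaussian only moves its mean to [c * s ^+ 2]; the factor is the
    moment generating function at [c]. *)
Lemma expRM_normal_pdf c s x : s != 0 ->
  expR (c * x) * normal_pdf 0 s x =
  expR (c ^+ 2 * s ^+ 2 / 2) * normal_pdf (c * s ^+ 2) s x.
Proof.
move=> s0; rewrite !normal_pdfE// /normal_fun mulrCA [RHS]mulrCA -!expRD.
by congr (_ * expR _); field.
Qed.

Lemma integral_expR_normal_prob c s : s != 0 ->
  (\int[normal_prob 0 s]_x (expR (c * x))%:E = (expR (c ^+ 2 * s ^+ 2 / 2))%:E)%E.
Proof.
move=> s0; rewrite ge0_integral_normal_prob//; last first.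
  by apply/measurable_EFinP/measurableT_comp => //; exact: measurable_funM.
under eq_integral do rewrite -EFinM expRM_normal_pdf// EFinM.
rewrite ge0_integralZl//.
- by rewrite integral_normal_pdf mule1.
- by apply/measurable_EFinP; exact: measurable_normal_pdf.
- by move=> x _; rewrite lee_fin normal_pdf_ge0.
Qed.

Lemma std_normal_pdfE x :
  expR (- (x ^+ 2 / 2)) / Num.sqrt (2 * pi) = normal_pdf 0 1 x.
Proof.
rewrite normal_pdfE ?oner_eq0// /normal_peak /normal_fun mulrC.
rewrite subr0 expr1n mul1r mulNr mulr_natl.
by congr (_ * expR (- (_ / _))).
Qed.

Lemma fin_num_integral_normal_pdf m s (A : set R) : measurable A ->
  (\int[mu]_(x in A) (normal_pdf m s x)%:E)%E \is a fin_num.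
Proof.
by move=> mA; exact: (fin_num_measure (normal_prob m s)).
Qed.

Lemma std_gauss_tailE c :
  ((std_gauss_tail c)%:E = \int[mu]_(x in `[c, +oo[) (normal_pdf 0 1 x)%:E)%E.
Proof.
rewrite /std_gauss_tail /Rintegral.
under eq_integral do rewrite std_normal_pdfE.
by rewrite fineK// fin_num_integral_normal_pdf.
Qed.

Lemma integral_normal_pdf_itvcy m s : 0 < s ->
  (\int[mu]_(x in `[0%R, +oo[) (normal_pdf m s x)%:E =
  (std_gauss_tail (- (m / s)))%:E)%E.
Proof.
move=> s0; rewrite std_gauss_tailE.
pose F (x : R^o) : R^o := (x - m) / s.
have F'E : F^`()%classic = cst s^-1.
  apply/funext => x; rewrite /F derive1E deriveM// deriveD// derive_cst scaler0.
  by rewrite add0r derive_id derive_cst addr0 scaler1.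
have -> : - (m / s) = F 0 by rewrite /F sub0r mulNr.
rewrite (@increasing_ge0_integration_by_substitutiony _ F)//.
- apply: eq_integral => x _; rewrite F'E /= !normal_pdfE ?gt_eqF// /F.
  congr EFin; rewrite fctE /= /normal_fun /normal_peak subr0 expr1n mul1r.
  rewrite -mulrnAr sqrtrM ?sqr_ge0// sqrtr_sqr gtr0_norm// invfM.
  rewrite [s^-1 * _]mulrC -!mulrA [expR _ * _]mulrC.
  congr (_ * (_ * expR _)); field.
  by rewrite gt_eqF.
- by move=> x y _ _ xy; rewrite /F ltr_pM2r ?invr_gt0// ltrD2r.
- by rewrite F'E => ? _; exact: cvg_cst.
- by rewrite F'E; exact: is_cvg_cst.
- by rewrite F'E; exact: is_cvg_cst.
- split; first by move=> x _; exact: ex_derive.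
  apply: cvg_at_right_filter.
  apply: (@cvgM R^o); last exact: cvg_cst.
  by apply: (@cvgB _ R^o); [exact: cvg_id|exact: cvg_cst].
- by apply/gt0_cvgMly; [rewrite invr_gt0|exact: cvg_addrr].
- apply: continuous_subspaceT; apply: continuous_normal_pdf.
  exact: oner_neq0.
- by move=> x _; exact: normal_pdf_ge0.
Qed.

Lemma integral_expR_normr_normal_prob c s : 0 < s ->
  (\int[normal_prob 0 s]_x (expR (c * `|x|))%:E =
   (2 * expR (c ^+ 2 * s ^+ 2 / 2) * std_gauss_tail (- (c * s)))%:E)%E.
Proof.
move=> s0; have sn0 : s != 0 by rewrite gt_eqF.
have mf : measurable_fun setT (fun x : R => expR (c * `|x|)).
  apply: measurableT_comp => //; apply: measurable_funM => //.
rewrite ge0_integral_normal_prob//; last exact/measurable_EFinP.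
under eq_integral do rewrite -EFinM.
rewrite ge0_symfun_integralT; first last.
- move=> x /=; rewrite normrN !normal_pdfE// /normal_fun !subr0.
  by rewrite sqrrN.
- move=> x; apply: (@cvgM R^o); last exact: continuous_normal_pdf.
  apply: (cvg_comp _ expR); last exact: continuous_expR.
  apply: (@cvgM R^o); first exact: cvg_cst.
  exact: (@norm_continuous _ R^o).
- by move=> x; rewrite mulr_ge0 ?expR_ge0// normal_pdf_ge0.
have -> : [set x : R | 0 <= x] = `[0, +oo[%classic.
  by apply/seteqP; split=> x /=; rewrite in_itv/= andbT.
under eq_integral => x.
  rewrite inE/= in_itv/= andbT => x0; rewrite ger0_norm// expRM_normal_pdf// EFinM.
  over.
rewrite ge0_integralZl//; first last.
- by move=> x _; rewrite lee_fin normal_pdf_ge0.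
- apply/measurable_EFinP; apply: measurable_funTS; exact: measurable_normal_pdf.
rewrite integral_normal_pdf_itvcy// -!EFinM mulrA.
by congr (_ * std_gauss_tail (- _))%:E; field.
Qed.

Lemma integral_expR_normr_sub1_normal_prob c s : 0 <= c -> 0 < s ->
  (\int[normal_prob 0 s]_x (expR (c * `|x|) - 1)%:E =
   (2 * expR (c ^+ 2 * s ^+ 2 / 2) * std_gauss_tail (- (c * s)) - 1)%:E)%E.
Proof.
move=> c0 s0.
have mf : measurable_fun setT (fun x : R => (expR (c * `|x|) - 1)).
  by apply: measurable_funB => //; apply: measurableT_comp => //; apply: measurable_funM.
have := integral_expR_normr_normal_prob c s0.
(* Writing the exponential as its excess over 1 plus 1 turns a subtraction of integrals into the
   cancellation of a finite term. *)
under eq_integral do rewrite -[expR _](subrK 1) EFinD.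
rewrite ge0_integralD//; first last.
- exact/measurable_EFinP.
- by move=> x _; rewrite lee_fin subr_ge0 -expR0 ler_expR mulr_ge0.
rewrite [X in (_ + X)%E](_ : _ = 1%E); last first.
  have := @integral_cst _ _ R (normal_prob 0 s) setT measurableT 1%E.
  by rewrite mul1e => ->; exact: (@probability_setT _ _ _ (normal_prob 0 s)).
move=> H.
by rewrite EFinB -H addeK.
Qed.

End gaussian_integrals.

(* Laplace weight [e^{-rs}] of a possibly infinite time [s]. *)
Definition discount (R : realType) (r : R) (s : \bar R) : R :=
  if s == +oo%E then 0 else expR (- (r * fine s)).

(** * Exponential clocks stopped at a fixed time *)

Section exponential_clock.
Context {R : realType} (r : R) (r_gt0 : 0 < r).
Local Notation mu := (@lebesgue_measure R).

Lemma discount_ge0 s : 0 <= discount r s.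
Proof. by rewrite /discount; case: ifP => // _; exact: expR_ge0. Qed.

Lemma discount_le1 s : (0 <= s)%E -> discount r s <= 1.
Proof.
rewrite /discount; case: ifP => // _ s0.
by rewrite -expR0 ler_expR oppr_le0 mulr_ge0 ?(ltW r_gt0)// fine_ge0.
Qed.

Lemma le_discount s t : (0 <= s)%E -> (s <= t)%E -> discount r t <= discount r s.
Proof.
rewrite /discount; move: s t => [s| |] [t| |]//= s0 st.
by rewrite ler_expR lerN2 ler_pM2l.
Qed.

Lemma measurable_discount : measurable_fun setT (discount r : \bar R -> R).
Proof.
apply: measurable_fun_ifT => //.
  apply: (measurable_fun_bool true).
  rewrite setTI [X in measurable X](_ : _ = [set +oo%E]); first exact: emeasurable_set1.
  by apply/seteqP; split=> x /= /eqP.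
apply: measurableT_comp => //; apply: measurableT_comp => //.
by apply: measurable_funM => //; exact: measurable_fine.
Qed.

Lemma exponential_prob_itvoy (x : R) : 0 <= x ->
  exponential_prob r `]x, +oo[ = (expR (- (r * x)))%:E.
Proof.
move=> x0; rewrite /exponential_prob integral_itv_obnd_cbnd; last first.
  by apply/measurable_funTS/measurable_EFinP; exact: measurable_exponential_pdf.
have cE : continuous (fun z : R => expR (- r * z)).
  move=> z; apply: continuous_comp; last exact: continuous_expR.
  by apply: continuousM => //; exact: cst_continuous.
rewrite (@ge0_continuous_FTC2y _ _ (fun x => - (expR (- r * x))) _ 0)//.
- by rewrite EFinN oppeK add0e mulNr.
- by move=> y _; apply: exponential_pdf_ge0; exact: ltW.
- apply: (@continuous_subspaceW R^o _ _ [set` `[0, +oo[%R]); last first.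
    exact: within_continuous_exponential_pdf.
  by apply: subset_itvr; rewrite bnd_simp.
- rewrite -oppr0; apply: cvgN.
  rewrite (_ : (fun x => expR (- r * x)) =
               (fun z => expR (- z)) \o (fun z => r * z)); last first.
    by apply: eq_fun => y; rewrite mulNr.
  apply: (@cvg_comp _ _ _ _ _ _ (pinfty_nbhs R)); last exact: cvgr_expR.
  exact: gt0_cvgMry.
- by apply: cvgN; apply/cvg_at_right_filter; exact: cE.
- move=> y yx; apply: derive1_exponential_pdf; move: yx; rewrite !in_itv/= !andbT.
  exact: le_lt_trans.
Qed.

Context d (Omega : measurableType d) (P : probability Omega R).
Context (T : {RV P >-> R}) (T_law : has_law P T (exponential_prob r)).

(** Through this identity the Laplace transform of an independent crossing time becomes the
    probability that the crossing precedes the clock. *)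
Lemma exponential_clock_gt (s : \bar R) : (0 <= s)%E ->
  P [set w | (s < (T w)%:E)%E] = (discount r s)%:E.
Proof.
rewrite /discount; case: s => [x| |] //= x0; last first.
  rewrite (_ : [set _ | _] = set0) ?measure0// -subset0 => w /=.
  by rewrite ltNge leey.
rewrite -exponential_prob_itvoy// -T_law//; congr (P _).
by apply/seteqP; split=> w /=; rewrite in_itv/= andbT lte_fin.
Qed.

Lemma exponential_clock_lt0 : P [set w | T w < 0] = 0%E.
Proof.
transitivity (exponential_prob r `]-oo, 0[).
  rewrite -(T_law (measurable_itv _)).
  by congr (P _); apply/seteqP; split=> w /=; rewrite in_itv.
rewrite /exponential_prob integral0_eq// => x /=; rewrite in_itv/= => x0.
by rewrite lt0_exponential_pdf.
Qed.

(** Layer-cake formula: on [D] the tail of [X] is that of the clock, which is [r^-1] times the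
    exponential density, so the mean is [r^-1] times the mass of [D]. It is applied to [[0, s[] and,
    for an infinite [s], to [[0, +oo[]. *)
Let integral_clock_ccdf (X : {RV P >-> R}) (D : set R) :
  measurable D -> D `<=` `[0, +oo[ -> (forall w, 0 <= X w) ->
  (forall u w, 0 <= u -> u < X w <-> D u /\ u < T w) ->
  (\int[P]_w (X w)%:E = r^-1%:E * exponential_prob r D)%E.
Proof.
move=> mD D0 X0 XD; rewrite -expectation_def ge0_expectation_ccdf//.
have -> : (exponential_prob r D =
    \int[mu]_(u in `[0%R, +oo[) ((EFin \o exponential_pdf r) \_ D) u)%E.
  by rewrite -integral_mkcondr setIidr.
rewrite -ge0_integralZl//; first last.
- by rewrite lee_fin invr_ge0 ltW.
- by move=> u _; apply: erestrict_ge0 => v _; rewrite lee_fin exponential_pdf_ge0// ltW.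
- apply/measurable_funTS/(measurable_restrictT _ _).1 => //.
  by apply/measurable_funTS/measurable_EFinP; exact: measurable_exponential_pdf.
apply: eq_integral => u; rewrite inE/= in_itv/= andbT => u0.
rewrite /ccdf /distribution /pushforward patchE; case: ifPn => [|]; rewrite ?inE ?notin_setE => Du.
  rewrite /= exponential_pdfE// -EFinM mulKf ?gt_eqF// mulNr.
  rewrite -[RHS](exponential_clock_gt (s := u%:E))//; congr (P _).
  apply/seteqP; split=> w /=; rewrite in_itv/= andbT lte_fin.
    by move=> /XD[].
  by move=> uT; apply/XD.
rewrite mule0 (_ : _ @^-1` _ = set0) ?measure0// -subset0 => w /=.
by rewrite in_itv/= andbT => /XD[].
Qed.

Let exponential_prob_itvcy (x : R) : 0 <= x ->
  exponential_prob r `[x, +oo[ = (expR (- (r * x)))%:E.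
Proof.
move=> x0; rewrite -exponential_prob_itvoy// /exponential_prob.
rewrite integral_itv_obnd_cbnd//.
by apply/measurable_funTS/measurable_EFinP; exact: measurable_exponential_pdf.
Qed.

(** The maximum with 0 is there because the law makes the clock nonnegative only almost surely. *)
Lemma integral_mine_clock (s : \bar R) : (0 <= s)%E ->
  (\int[P]_w mine s (Num.max 0 (T w))%:E = (r^-1 * (1 - discount r s))%:E)%E.
Proof.
case: s => [x| |]// x0; rewrite EFinM /discount/=.
- rewrite lee_fin in x0.
  have mX : measurable_fun setT (fun w => Num.min x (Num.max 0 (T w))).
    by apply: measurable_minr => //; exact: measurable_maxr.
  transitivity (\int[P]_w (mfun_Sub (mem_set mX) w)%:E)%E.
    by apply: eq_integral => w _ /=; rewrite EFin_min.
  rewrite (@integral_clock_ccdf _ `[0, x[)//; first last.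
  + move=> u w u0 /=; rewrite in_itv/= u0/= lt_min lt_max [u < 0]ltNge u0/=.
    by split=> [/andP[]|[-> ->]].
  + by move=> w /=; rewrite le_min x0/= le_max lexx.
  + by apply: subset_itvl; rewrite bnd_simp.
  congr (_ * _)%E; rewrite EFinB.
  suff -> : (1 = exponential_prob r `[0%R, x[ + (expR (- (r * x)))%:E)%E by rewrite addeK.
  transitivity (exponential_prob r (`[0%R, x[ `|` `[x, +oo[)).
    rewrite -itv_bndbnd_setU ?bnd_simp//.
    by rewrite exponential_prob_itvcy// mulr0 oppr0 expR0.
  rewrite -exponential_prob_itvcy//; apply: measureU => //.
  apply/seteqP; split=> // u /= []; rewrite !in_itv/= andbT => /andP[_ ux].
  by move=> /(lt_le_trans ux); rewrite ltxx.
- have mX : measurable_fun setT (fun w => Num.max 0 (T w)) by exact: measurable_maxr.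
  transitivity (\int[P]_w (mfun_Sub (mem_set mX) w)%:E)%E.
    by apply: eq_integral => w _ /=; rewrite min_r// leey.
  rewrite (@integral_clock_ccdf _ `[0, +oo[)//; first last.
  + move=> u w u0 /=; rewrite in_itv/= u0/= lt_max [u < 0]ltNge u0/=.
    by split=> [|[]].
  + by move=> w /=; rewrite le_max lexx.
  + by rewrite exponential_prob_itvcy// mulr0 oppr0 expR0 addr0.
Qed.

End exponential_clock.

(** * Discounted passage times of a random walk *)

Section sub_salgebra.
Context d (Omega : measurableType d) (G : set (set Omega)).

Lemma sub_salgebra_measurable_fun d' (T : measurableType d') (f : Omega -> T) :
  G `<=` measurable -> measurable_fun (setT : set (g_sigma_algebraType G)) f ->
  measurable_fun setT f.
Proof.
move=> Gm mf _ U mU; have := mf measurableT U mU.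
by apply: smallest_sub => //; exact: sigma_algebra_measurable.
Qed.

Lemma salgebra_preimage d' (T : measurableType d') (f : Omega -> T) U :
  measurable_fun (setT : set (g_sigma_algebraType G)) f -> measurable U ->
  <<s G >> (f @^-1` U).
Proof. by move=> mf mU; rewrite -[_ @^-1` _]setTI; exact: mf. Qed.

Lemma sigma_of_measurable_fun (R : realType) (Y : Omega -> R) :
  sigma_of Y `<=` G -> measurable_fun (setT : set (g_sigma_algebraType G)) Y.
Proof. by move=> YG _ U mU; apply: sub_gen_smallest; apply: YG; exists U. Qed.

End sub_salgebra.

Section sigma_of_lemmas.
Context d (Omega : measurableType d) (R : realType).

Lemma sigma_of_sub_measurable (P : probability Omega R) (Y : {RV P >-> R}) :
  sigma_of Y `<=` measurable.
Proof. by move=> _ [U mU <-]; exact: measurable_funP. Qed.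

Lemma sigma_of_setI (Y : Omega -> R) : setI_closed (sigma_of Y).
Proof.
move=> _ _ [U mU <-] [V mV <-]; exists (U `&` V); first exact: measurableI.
by rewrite !setTI preimage_setI.
Qed.

Lemma sigma_of_setT (Y : Omega -> R) : sigma_of Y setT.
Proof. by exists setT => //; rewrite setTI. Qed.

End sigma_of_lemmas.

Section random_walk.
Context d (Omega : measurableType d) (R : realType) (P : probability Omega R).
Context (Y : nat -> {RV P >-> R}) (v b : R).
Hypotheses (b_gt0 : 0 < b) (Y0 : forall w, Y 0 w = 0).
Local Notation dY n := (Y n.+1 \- Y n).
Hypothesis dY_indep : mutually_independent P (fun n => sigma_of (dY n)).
Hypothesis dY_mgf : forall l n,
  (\int[P]_w (expR (l * dY n w))%:E = (expR (l ^+ 2 * v / 2))%:E)%E.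

Definition stays_below n : set Omega := [set w | forall j, (j <= n)%N -> Y j w <= b].
(** The index is the last time spent below the level: the exit itself happens at step [n.+1], whence
    the powers [n.+1] in the discounted sums. *)
Definition first_exit n : set Omega := [set w | stays_below n w /\ b < Y n.+1 w].

Local Notation past n := (\bigcup_(i in [set i | (i < n)%N]) sigma_of (dY i)).

Let Y_past n j : (j <= n)%N ->
  measurable_fun (setT : set (g_sigma_algebraType (past n))) (Y j).
Proof.
elim: j => [_|j IH jn].
  by rewrite (_ : (Y 0 : _ -> _) = cst 0)//; apply/funext.
rewrite (_ : (Y j.+1 : _ -> _) = (fun w => Y j w + dY j w)); last first.
  by apply/funext => w; rewrite /= addrC subrK.
have dYj : measurable_fun (setT : set (g_sigma_algebraType (past n))) (dY j).
  by apply: sigma_of_measurable_fun => A HA; exists j.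
exact: (measurable_funD (IH (ltnW jn)) dYj).
Qed.

Let past_measurable n : past n `<=` measurable.
Proof. by move=> A [i _] [U mU <-]; apply: measurable_funB. Qed.

Let stays_below_past n : <<s past n >> (stays_below n).
Proof.
rewrite (_ : stays_below n = \bigcap_(j in `I_n.+1) (Y j @^-1` [set` `]-oo, b]])).
  apply: (@bigcap_measurable _ (g_sigma_algebraType (past n))); first by exists 0%N.
  move=> j jn; apply: salgebra_preimage; last exact: measurable_itv.
  exact: Y_past.
by apply/seteqP; split=> w /= H j /H; rewrite /= in_itv.
Qed.

Lemma measurable_stays_below n : measurable (stays_below n).
Proof.
exact: (smallest_sub (@sigma_algebra_measurable _ _) (@past_measurable n)
  (@stays_below_past n)).
Qed.

Lemma measurable_first_exit n : measurable (first_exit n).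
Proof.
apply: measurableI; first exact: measurable_stays_below.
rewrite [X in measurable X](_ : _ = Y n.+1 @^-1` [set` `]b, +oo[]).
  exact: measurable_funPTI.
by apply/seteqP; split=> w /=; rewrite in_itv/= andbT.
Qed.

Let mexp (l : R) (Z : {RV P >-> R}) : measurable_fun setT (fun w => (expR (l * Z w))).
Proof. by apply: measurableT_comp => //; exact: measurable_funM. Qed.

Let killed l n := (\int[P]_w (\1_(stays_below n) w * expR (l * Y n w))%:E)%E.
Let exit l n := (\int[P]_w (\1_(first_exit n) w * expR (l * Y n.+1 w))%:E)%E.

(** The next increment is independent of the past, so it multiplies the killed moment by its own
    exponential moment; the surviving mass then splits according to whether this step stays below
    [b] or exits. *)
Let killed_step l n :
  (killed l n * (expR (l ^+ 2 * v / 2))%:E = killed l n.+1 + exit l n)%E.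
Proof.
rewrite /killed -(dY_mgf l n) -ge0_integralM_indep//; first last.
- move=> U V mU mV.
  have K : [set i | (i < n)%N] `&` [set n] = set0.
    apply/seteqP; split => // i [/= ltin ein].
    by rewrite ein ltnn in ltin.
  apply: (mutually_independent_grouping _ _ _ K dY_indep).
  + by move=> i A [W mW <-]; apply: measurable_funB.
  + by move=> i; exact: sigma_of_setI.
  + by move=> i; exact: sigma_of_setT.
  + apply: salgebra_preimage => //; apply/measurable_EFinP.
    apply: measurable_funM.
      by apply: measurable_indic; exact: stays_below_past.
    apply: measurableT_comp => //; apply: measurable_funM => //.
    exact: (@Y_past n n).
  + apply: salgebra_preimage => //; apply/measurable_EFinP.
    apply: measurableT_comp => //; apply: measurable_funM => //.
    by apply: sigma_of_measurable_fun => A HA; exists n.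
- apply/measurable_EFinP; apply: measurableT_comp => //; exact: measurable_funM.
- apply/measurable_EFinP; apply: measurable_funM => //.
  by apply: measurable_indic; exact: measurable_stays_below.
rewrite -ge0_integralD//; first last.
- by apply/measurable_EFinP; apply: measurable_funM => //;
    apply: measurable_indic; exact: measurable_first_exit.
- by apply/measurable_EFinP; apply: measurable_funM => //;
    apply: measurable_indic; exact: measurable_stays_below.
apply: eq_integral => w _; rewrite -EFinM -EFinD -mulrA -expRD -mulrDr.
have -> : Y n w + dY n w = Y n.+1 w by rewrite /= addrC subrK.
rewrite -mulrDl; congr (_ * _)%:E; rewrite !indicE -natrD; congr (_%:R).
have [An|An] := pselect (stays_below n w); last first.
  rewrite memNset// !memNset//; first by move=> [].
  by move=> An1; apply: An => j jn; apply: An1; exact: leqW.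
rewrite mem_set//; have [Yb|Yb] := leP (Y n.+1 w) b.
  rewrite mem_set ?memNset//; first by move=> [_]; rewrite ltNge Yb.
  by move=> j; rewrite leq_eqVlt => /predU1P[->//|]; exact: An.
rewrite memNset ?mem_set// => /(_ n.+1 (leqnn _)).
by rewrite leNgt Yb.
Qed.

Let killed0 l : killed l 0 = 1%E.
Proof.
rewrite /killed.
have -> : (fun w => (\1_(stays_below 0) w * expR (l * Y 0 w))%:E) = cst (1%E : \bar R).
  apply/funext => w; rewrite Y0 mulr0 expR0 mulr1 indicE mem_set//.
  by move=> j; rewrite leqn0 => /eqP ->; rewrite Y0 ltW.
by rewrite integral_cst//= probability_setT mul1e.
Qed.

Let killed_ge0 l n : (0 <= killed l n)%E.
Proof. by apply: integral_ge0 => w _; rewrite lee_fin mulr_ge0 ?expR_ge0. Qed.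

Let exit_ge0 l n : (0 <= exit l n)%E.
Proof. by apply: integral_ge0 => w _; rewrite lee_fin mulr_ge0 ?expR_ge0. Qed.

Let killed_le l n : 0 <= l -> (killed l n <= (expR (l * b))%:E)%E.
Proof.
move=> l0; apply: (@le_trans _ _ (\int[P]_w cst (expR (l * b))%:E w)%E); last first.
  by rewrite integral_cst//= probability_setT mule1.
apply: ge0_le_integral => //.
- by apply/measurable_EFinP; apply: measurable_funM => //;
    apply: measurable_indic; exact: measurable_stays_below.
- move=> w _; rewrite lee_fin indicE; case: (boolP (_ \in _)) => [|_].
    rewrite inE => /(_ n (leqnn _)) Yb; rewrite mul1r ler_expR; exact: ler_wpM2l.
  by rewrite mul0r expR_ge0.
Qed.

Let killed_fin l n : 0 <= l -> killed l n \is a fin_num.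
Proof.
move=> l0; rewrite ge0_fin_numE//; apply: le_lt_trans (killed_le n l0) _.
by rewrite ltry.
Qed.

Let exit_fin l n : 0 <= l -> exit l n \is a fin_num.
Proof.
move=> l0; rewrite ge0_fin_numE//.
apply: (@le_lt_trans _ _ (killed l n.+1 + exit l n)%E); first by rewrite leeDr.
by rewrite -killed_step -ge0_fin_numE ?mule_ge0// ?lee_fin ?expR_ge0// fin_numM// killed_fin.
Qed.

Let exit_ge l n : 0 <= l ->
  ((expR (l * b))%:E * P (first_exit n) <= exit l n)%E.
Proof.
move=> l0; have mH := measurable_first_exit n.
have m1 : measurable_fun setT (fun w => (\1_(first_exit n) w)%:E : \bar R).
  exact/measurable_EFinP/measurable_indic.
rewrite -[first_exit n]setIT -integral_indic// -ge0_integralZl//.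
apply: ge0_le_integral => //.
- exact: emeasurable_funM.
- by apply/measurable_EFinP; exact: measurable_funM.
- move=> w _; rewrite -EFinM lee_fin indicE; case: (boolP (_ \in _)) => [|_].
    by rewrite inE => -[_ /ltW Yb]; rewrite mul1r mulr1 ler_expR ler_wpM2l.
  by rewrite mul0r mulr0.
Qed.

(** An exit below [b + e] costs at most the first term. Beyond [b + e], raising the exponent from
    [t] to [l] on the excess only increases the weight, so large overshoots are charged to the
    [l]-moment with a factor that is small for large [l]. *)
Let exit_le t l e n : 0 <= t -> t <= l -> 0 <= e ->
  (exit t n <= (expR (t * (b + e)))%:E * P (first_exit n) +
               (expR (t * (b + e)) * expR (- (l * (b + e))))%:E * exit l n)%E.
Proof.
move=> t0 tl e0; have mH := measurable_first_exit n.
have m1 : measurable_fun setT (fun w => (\1_(first_exit n) w)%:E : \bar R).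
  exact/measurable_EFinP/measurable_indic.
have me k : measurable_fun setT
    (fun w => (\1_(first_exit n) w * expR (k * Y n.+1 w))%:E : \bar R).
  by apply/measurable_EFinP; apply: measurable_funM.
have pos k w : (0 <= (\1_(first_exit n) w * expR (k * Y n.+1 w))%:E)%E.
  by rewrite lee_fin mulr_ge0 ?expR_ge0.
rewrite -[first_exit n]setIT -integral_indic// -ge0_integralZl// -ge0_integralZl//.
rewrite -ge0_integralD//; first last.
- exact: emeasurable_funM.
- exact: emeasurable_funM.
apply: ge0_le_integral => //.
- by apply: emeasurable_funD; exact: emeasurable_funM.
move=> w _; rewrite -!EFinM -EFinD lee_fin indicE.
case: (boolP (_ \in _)) => [wH|_]; last by rewrite !mul0r !mulr0 addr0.
rewrite !mul1r !mulr1; have [Yb|Yb] := leP (Y n.+1 w) (b + e).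
  by rewrite -[leLHS]addr0 lerD// ler_expR ler_wpM2l.
rewrite -[leLHS]add0r lerD ?expR_ge0// -!expRD ler_expR.
have : t * (Y n.+1 w - (b + e)) <= l * (Y n.+1 w - (b + e)).
  by rewrite ler_wpM2r// subr_ge0 ltW.
lra.
Qed.

Local Notation d_ l := (expR (- (l ^+ 2 * v / 2))).

(** A truncated Laplace transform of the exit step. Stopping at [N] keeps every identity a finite
    sum. *)
Definition discounted_exit l N : R :=
  \sum_(n < N) d_ l ^+ n.+1 * fine (P (first_exit n)).

Let P_exit n : P (first_exit n) = (fine (P (first_exit n)))%:E.
Proof. by rewrite fineK// fin_num_measure//; exact: measurable_first_exit. Qed.

Let u l n : R := fine (killed l n).
Let x l n : R := fine (exit l n).

Let u_step l n : 0 <= l -> u l n * expR (l ^+ 2 * v / 2) = u l n.+1 + x l n.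
Proof.
move=> l0; have := killed_step l n.
rewrite -(fineK (killed_fin n l0)) -(fineK (killed_fin n.+1 l0)) -(fineK (exit_fin n l0)).
by rewrite -EFinM -EFinD => -[].
Qed.

Let u0 l : u l 0 = 1. Proof. by rewrite /u killed0. Qed.

Let u_ge0 l n : 0 <= u l n. Proof. exact: fine_ge0. Qed.

Let u_le l n : 0 <= l -> u l n <= expR (l * b).
Proof. by move=> l0; rewrite -lee_fin fineK ?killed_fin// killed_le. Qed.

(** Multiplied by the discount, the one-step identity telescopes. This is optional stopping of the
    exponential martingale at the exit or at step [N]; the last term is what has not yet exited. *)
Let u_sum l N : 0 <= l -> \sum_(n < N) d_ l ^+ n.+1 * x l n = 1 - d_ l ^+ N * u l N.
Proof.
move=> l0; elim: N => [|N IH]; first by rewrite big_ord0 expr0 mul1r u0 subrr.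
rewrite big_ord_recr/= IH.
have -> : x l N = u l N * expR (l ^+ 2 * v / 2) - u l N.+1 by rewrite u_step// addrC addKr.
have e1 : d_ l * expR (l ^+ 2 * v / 2) = 1 by rewrite -expRD addNr expR0.
rewrite [d_ l ^+ N.+1]exprSr; move: e1.
set a := expR (l ^+ 2 * v / 2); set D := d_ l ^+ N => e1.
have -> : D * d_ l * (u l N * a - u l N.+1) =
  D * u l N * (d_ l * a) - D * d_ l * u l N.+1 by ring.
by rewrite e1; ring.
Qed.

(** The walk is above [b] when it exits, so each exit carries weight at least [expR (l * b)], and
    the unexited remainder is nonnegative. *)
Lemma discounted_exit_le l N : 0 <= l -> discounted_exit l N <= expR (- (l * b)).
Proof.
move=> l0; rewrite expRN -[leRHS]mul1r ler_pdivlMr ?expR_gt0//.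
apply: (@le_trans _ _ (\sum_(n < N) d_ l ^+ n.+1 * x l n)); last first.
  by rewrite u_sum// gerBl mulr_ge0// exprn_ge0// expR_ge0.
rewrite /discounted_exit mulr_suml; apply: ler_sum => n _.
rewrite -[leLHS]mulrA ler_wpM2l ?exprn_ge0 ?expR_ge0// mulrC.
by have := exit_ge n l0; rewrite P_exit -(fineK (exit_fin n l0)) -EFinM lee_fin.
Qed.

(** The weight uses [l] but the discount uses [t], so telescoping leaves a gain [q - 1] at each
    step. Killed moments are at most [expR (l * b)] and a geometric series sums the gains; the
    resulting quotient stays of order [l ^+ 2 / t ^+ 2] as [v] tends to 0. *)
Let x_sum_le t l N : 0 <= v -> 0 < t -> t <= l -> d_ t < 1 ->
  \sum_(n < N) d_ t ^+ n.+1 * x l n <=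
  1 + expR (l * b) * ((expR ((l ^+ 2 - t ^+ 2) * v / 2) - 1) / (1 - d_ t)).
Proof.
move=> v0 t0 tl d1; have l0 : 0 <= l by apply: ltW; exact: lt_le_trans tl.
have d0 : 0 <= d_ t by exact: expR_ge0.
set q := expR ((l ^+ 2 - t ^+ 2) * v / 2).
have qE : d_ t * expR (l ^+ 2 * v / 2) = q by rewrite -expRD; congr expR; field.
have q1 : 1 <= q.
  rewrite -expR0 ler_expR mulr_ge0// mulr_ge0// subr_ge0.
  by rewrite ler_sqr// nnegrE ltW.
have -> : \sum_(n < N) d_ t ^+ n.+1 * x l n =
    1 - d_ t ^+ N * u l N + (q - 1) * \sum_(n < N) d_ t ^+ n * u l n.
  elim: N => [|N IH]; first by rewrite !big_ord0 expr0 mul1r u0 subrr mulr0 addr0.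
  rewrite !big_ord_recr/= IH.
  have -> : x l N = u l N * expR (l ^+ 2 * v / 2) - u l N.+1 by rewrite u_step// addrC addKr.
  by rewrite -qE [d_ t ^+ N.+1]exprS; ring.
apply: lerD; first by rewrite gerBl mulr_ge0// exprn_ge0.
rewrite mulrCA ler_wpM2l ?subr_ge0//.
apply: (@le_trans _ _ (\sum_(n < N) d_ t ^+ n * expR (l * b))).
  by apply: ler_sum => n _; rewrite ler_wpM2l ?exprn_ge0 ?u_le.
rewrite -mulr_suml mulrC ler_wpM2l ?expR_ge0//.
rewrite -[leRHS]mul1r ler_pdivlMr ?subr_gt0//.
have := subrX1 (d_ t) N; have : 0 <= d_ t ^+ N by rewrite exprn_ge0.
set S := \sum_(i < N) _; set dN := _ ^+ N; lra.
Qed.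

(** The error terms vanish in a definite order: the last one as [N] grows, the other two as [l]
    grows with [v] so small that [l ^+ 2 * v] stays bounded. The margin [e] on the level goes
    last. *)
Lemma discounted_exit_ge t l e N : 0 <= v -> 0 < t -> t <= l -> 0 <= e ->
  d_ t < 1 ->
  expR (- (t * (b + e))) <= discounted_exit t N + expR (- (l * (b + e))) +
    expR (- (l * e)) * ((expR ((l ^+ 2 - t ^+ 2) * v / 2) - 1) / (1 - d_ t)) +
    d_ t ^+ N.
Proof.
move=> v0 t0 tl e0 d1; have l0 : 0 <= l by apply: ltW; exact: lt_le_trans tl.
have d0 : 0 <= d_ t by exact: expR_ge0.
set K := (_ / (1 - d_ t)).
rewrite expRN -[leLHS]mul1r ler_pdivrMr ?expR_gt0//.
have xle n : x t n <= expR (t * (b + e)) * fine (P (first_exit n)) +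
    (expR (t * (b + e)) * expR (- (l * (b + e)))) * x l n.
  have := exit_le n (ltW t0) tl e0.
  by rewrite P_exit -(fineK (exit_fin n (ltW t0))) -(fineK (exit_fin n l0)) -!EFinM -EFinD lee_fin.
have H1 : 1 - d_ t ^+ N * u t N <= expR (t * (b + e)) * discounted_exit t N +
    expR (t * (b + e)) * expR (- (l * (b + e))) * (1 + expR (l * b) * K).
  rewrite -u_sum; last exact: ltW.
  apply: (@le_trans _ _ (\sum_(n < N) d_ t ^+ n.+1 *
      (expR (t * (b + e)) * fine (P (first_exit n)) +
      (expR (t * (b + e)) * expR (- (l * (b + e)))) * x l n))).
    by apply: ler_sum => n _; rewrite ler_wpM2l ?exprn_ge0.
  under eq_bigr do rewrite mulrDr.
  rewrite big_split/= lerD//.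
    by rewrite /discounted_exit mulr_sumr; apply: ler_sum => n _; rewrite mulrCA.
  under eq_bigr do rewrite mulrCA.
  rewrite -mulr_sumr ler_wpM2l ?mulr_ge0 ?expR_ge0//.
  exact: x_sum_le.
have H2 : d_ t ^+ N * u t N <= d_ t ^+ N * expR (t * (b + e)).
  rewrite ler_wpM2l ?exprn_ge0//; apply: le_trans (u_le _ (ltW t0)) _.
  by rewrite ler_expR ler_wpM2l ?(ltW t0)// lerDl.
have -> : expR (- (l * e)) = expR (- (l * (b + e))) * expR (l * b).
  by rewrite -expRD; congr expR; ring.
move: H1 H2; set E1 := expR (t * _); set E2 := expR (- _); set E3 := expR (l * b).
set dN := d_ t ^+ N; set S := discounted_exit t N; set uN := u t N.
lra.
Qed.

End random_walk.

(** * Crossing times of Brownian motion *)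

Definition dyadic {R : realType} (m k : nat) : R := k%:R / 2 ^+ m.

Lemma dyadic_ge0 {R : realType} m k : 0 <= dyadic m k :> R.
Proof. by rewrite /dyadic divr_ge0// exprn_ge0. Qed.

Lemma dyadic0 {R : realType} m : dyadic m 0 = 0 :> R.
Proof. by rewrite /dyadic mul0r. Qed.

Lemma dyadic_refine {R : realType} m n k :
  dyadic (m + n) (k * 2 ^ n) = dyadic m k :> R.
Proof.
by rewrite /dyadic exprD natrM natrX -mulf_div divff ?mulr1//.
Qed.

(* First time at which [e * B] exceeds [b]; by continuity of the paths it is
   enough to look at dyadic times, which makes it measurable. *)
Definition crossing_time (R : realType) (Omega : Type) (B : R -> Omega -> R)
    (e b : R) (w : Omega) : \bar R :=
  ereal_inf [set (dyadic z.1 z.2)%:E |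
    z in [set z : nat * nat | b < e * B (dyadic z.1 z.2) w]].

Section crossing_time.
Context (R : realType) (Omega : Type).
Implicit Types (B : R -> Omega -> R) (e b : R).

Lemma crossing_time_ge0 B e b w : (0 <= crossing_time B e b w)%E.
Proof. by apply: le_ereal_inf_tmp => _ [z _ <-]; rewrite lee_fin dyadic_ge0. Qed.

Lemma crossing_time_le B e b w m k :
  b < e * B (dyadic m k) w -> (crossing_time B e b w <= (dyadic m k)%:E)%E.
Proof. by move=> H; apply: ereal_inf_lbound; exists (m, k). Qed.

Lemma crossing_time_lt B e b w (x : \bar R) : (crossing_time B e b w < x)%E ->
  exists m k, b < e * B (dyadic m k) w /\ ((dyadic m k)%:E < x)%E.
Proof. by move=> /ereal_inf_lt[_ [[m k] /= H <-] tx]; exists m, k. Qed.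

End crossing_time.

(** Being below [x] is a countable union over dyadic times. Measurability is stated for the
    sigma-algebra generated by the path, so that crossing times inherit the independence of the
    paths. *)
Lemma measurable_crossing_time d (Omega : measurableType d) (R : realType)
    (B : R -> Omega -> R) (e b : R) (G : set (set Omega)) :
  (forall t, 0 <= t -> sigma_of (B t) `<=` G) ->
  measurable_fun (setT : set (g_sigma_algebraType G)) (crossing_time B e b).
Proof.
move=> BG; apply: (measurability _ (ErealGenInftyO.measurableE R)).
move=> _ [_ [x ->] <-]; rewrite setTI.
rewrite (_ : _ @^-1` _ = \bigcup_(m in setT) \bigcup_(k in [set k | dyadic m k < x])
    [set w | b < e * B (dyadic m k) w]).
  apply: (@bigcup_measurable _ (g_sigma_algebraType G)) => m _.
  apply: (@bigcup_measurable _ (g_sigma_algebraType G)) => k _.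
  rewrite (_ : [set w | _] = (fun w => e * B (dyadic m k) w) @^-1` [set` `]b, +oo[]).
    apply: salgebra_preimage => //; apply: measurable_funM => //.
    by apply: sigma_of_measurable_fun; apply: BG; exact: dyadic_ge0.
  by apply/seteqP; split=> w /=; rewrite in_itv/= andbT.
apply/seteqP; split=> w /=; rewrite in_itv/=.
  by move=> /(@crossing_time_lt _ _ B e b w)[m [k [bB kx]]]; exists m => //; exists k.
move=> [m _ [k /= kx bB]]; apply: le_lt_trans (@crossing_time_le _ _ B e b w m k bB) _.
by rewrite lte_fin.
Qed.

Section first_exit_lemmas.
Context d (Omega : measurableType d) (R : realType) (P : probability Omega R).
Context (Y : nat -> {RV P >-> R}) (b : R).

Lemma first_exit_uniq n n' w : first_exit Y b n w -> first_exit Y b n' w -> n = n'.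
Proof.
wlog : n n' / (n < n')%N => [H Hn Hn'|nn' [_ bn] [+ _]].
  by case: (ltngtP n n') => // nn'; [exact: H|exact/esym/H].
by move=> /(_ _ nn'); rewrite leNgt bn.
Qed.

Lemma first_exit_exists k w : Y 0 w <= b -> b < Y k w ->
  exists2 n, (n < k)%N & first_exit Y b n w.
Proof.
move=> Y0 bk; have ex : exists j, b < Y j w by exists k.
case: (ex_minnP ex) => -[|n] bn nmin; first by rewrite leNgt bn in Y0.
exists n; first exact: nmin.
split=> // j jn; rewrite leNgt; apply/negP => /nmin.
by rewrite leqNgt ltnS jn.
Qed.

Lemma discounted_sum_first_exit (q : R) N n w : (n < N)%N -> first_exit Y b n w ->
  \sum_(i < N) q ^+ i.+1 * \1_(first_exit Y b i) w = q ^+ n.+1.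
Proof.
move=> nN Hn; rewrite (bigD1 (Ordinal nN))//= indicE mem_set// mulr1 big1 ?addr0//.
move=> i ni; rewrite indicE memNset ?mulr0// => Hi.
by move/eqP: ni; apply; apply/val_inj => /=; exact: first_exit_uniq Hi Hn.
Qed.

Lemma discounted_sum_first_exit0 (q : R) N w :
  (forall n, (n < N)%N -> ~ first_exit Y b n w) ->
  \sum_(i < N) q ^+ i.+1 * \1_(first_exit Y b i) w = 0.
Proof.
by move=> H; rewrite big1// => i _; rewrite indicE memNset ?mulr0//; exact: H.
Qed.

End first_exit_lemmas.

Lemma expR_pow_small (R : realType) (x eta : R) : 0 < x -> 0 < eta ->
  exists N, expR (- x) ^+ N <= eta.
Proof.
move=> x0 eta0; exists (Num.truncn (x * eta)^-1).+1; set N := (_.+1).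
have xe0 : 0 < x * eta by rewrite mulr_gt0.
rewrite -expRM_natr mulNr expRN invf_ple ?posrE ?expR_gt0//.
apply: le_trans (expR_ge1Dx _); rewrite -[leLHS]add0r lerD//.
have /ltW : (x * eta)^-1 < N%:R by exact: truncnS_gt.
by rewrite invfM mulrC ler_pdivrMr// mulrC.
Qed.

Lemma expR_sub1_le (R : realType) (x : R) : 0 <= x -> x <= 2^-1 -> expR x - 1 <= 2 * x.
Proof.
move=> x0 x1; have := expR_ge1Dx (- x); rewrite expRN -[leRHS]mul1r ler_pdivlMr ?expR_gt0// => H.
have : 0 <= expR x by exact: expR_ge0.
nra.
Qed.

Lemma sub1_expRN_ge (R : realType) (x : R) : 0 <= x -> x <= 1 -> x / 2 <= 1 - expR (- x).
Proof.
move=> x0 x1; have x10 : 0 < 1 + x by rewrite ltr_pwDl.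
have : expR (- x) <= (1 + x)^-1.
  by rewrite expRN lef_pV2 ?posrE ?expR_gt0//; exact: expR_ge1Dx.
rewrite lerBrDl -lerBrDr => /le_trans; apply.
by rewrite -[leLHS]mul1r ler_pdivrMr//; nra.
Qed.

Lemma expR_beats_square (R : realType) (x eta : R) : 0 < x -> 0 < eta ->
  (* Since [expR y >= y ^+ 3 / 6], the constant 30 yields [5 * j ^+ 2], which dominates
     [1 + 4 * j ^+ 2] for [j >= 1]. *)
  exists2 j : nat, (0 < j)%N & expR (- (j%:R * x)) * (1 + 4 * j%:R ^+ 2) <= eta.
Proof.
move=> x0 eta0; pose j := (Num.truncn (30 / (x ^+ 3 * eta))).+1.
exists j => //.
have x30 : 0 < x ^+ 3 by rewrite exprn_gt0.
have j0 : 1 <= j%:R :> R by rewrite ler1n.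
have jx0 : 0 <= j%:R * x by rewrite mulr_ge0// ltW.
have H1 : 30 <= j%:R * (x ^+ 3 * eta).
  by rewrite -ler_pdivrMr ?mulr_gt0//; apply: ltW; exact: truncnS_gt.
have H2 := expR_ge1Dxn 2 jx0.
rewrite expRN mulrC ler_pdivrMr ?expR_gt0//.
have H3 : (j%:R * x) ^+ 3 / 6 <= expR (j%:R * x).
  by apply: le_trans H2; rewrite lerDr.
apply: (@le_trans _ _ (eta * ((j%:R * x) ^+ 3 / 6))); last by rewrite ler_wpM2l// ltW.
have -> : eta * ((j%:R * x) ^+ 3 / 6) = (j%:R * (x ^+ 3 * eta)) * (j%:R ^+ 2 / 6) by field.
apply: (@le_trans _ _ (30 * (j%:R ^+ 2 / 6))); last by rewrite ler_wpM2r// divr_ge0// sqr_ge0.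
have : 1 <= j%:R ^+ 2 :> R by rewrite exprn_ege1.
lra.
Qed.

(** * Laplace transform of the crossing time *)

Section brownian_crossing.
Context d (Omega : measurableType d) (R : realType) (P : probability Omega R).
Context (D e b th : R) (B : R -> {RV P >-> R}).
Hypotheses (D_gt0 : 0 < D) (e2 : e ^+ 2 = 1) (b_gt0 : 0 < b) (th_gt0 : 0 < th).
Hypothesis B_brownian : brownian_motion D B.

Local Notation r := (th ^+ 2 * D / 2).
Local Notation sigma := (crossing_time B e b).

Let mY m k : measurable_fun setT (fun w => e * B (dyadic m k) w).
Proof. exact: measurable_funM. Qed.

Let Y m k : {RV P >-> R} := mfun_Sub (mem_set (mY m k)).
Let v m : R := D / 2 ^+ m.

Let v_gt0 m : 0 < v m. Proof. by rewrite divr_gt0// exprn_gt0. Qed.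

Let Y0 m w : Y m 0 w = 0.
Proof. by rewrite /Y/= dyadic0 (brownian_start B_brownian) mulr0. Qed.

Let dyadicS m k : dyadic m k.+1 - dyadic m k = (2 ^+ m)^-1 :> R.
Proof. by rewrite /dyadic -mulrBl -natrB// subSnn mul1r. Qed.

Let ltr_dyadicS m k : dyadic m k < dyadic m k.+1 :> R.
Proof. by rewrite -subr_gt0 dyadicS invr_gt0 exprn_gt0. Qed.

Let dYE m k : Y m k.+1 \- Y m k =
  (fun w => e * (B (dyadic m k.+1) \- B (dyadic m k)) w).
Proof. by apply/funext => w; rewrite /Y/= mulrBr. Qed.

Let dY_indep m : mutually_independent P (fun n => sigma_of (Y m n.+1 \- Y m n)).
Proof.
move=> J A HA.
apply: (brownian_independent B_brownian (t := fun n => dyadic m n)).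
- exact: dyadic_ge0.
- by move=> n; exact/ltW.
- move=> n /HA[U mU <-]; exists ((fun x => e * x) @^-1` U).
    have me : measurable_fun setT (fun x : R => e * x) by exact: measurable_funM.
    by rewrite -[X in measurable X]setTI; exact: me.
  by rewrite dYE.
Qed.

Let dY_mgf m l n : (\int[P]_w (expR (l * (Y m n.+1 \- Y m n) w))%:E =
  (expR (l ^+ 2 * v m / 2))%:E)%E.
Proof.
have mf : measurable_fun setT (fun x : R => (expR (l * e * x))%:E : \bar R).
  by apply/measurable_EFinP/measurableT_comp => //; exact: measurable_funM.
have mdB : measurable_fun setT (B (dyadic m n.+1) \- B (dyadic m n)).
  exact: measurable_funB.
have := ge0_integral_has_law mdB
  (@brownian_increment _ _ _ _ _ _ B_brownian _ _ (dyadic_ge0 m n)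
    (ltr_dyadicS m n)) mf.
rewrite integral_expR_normal_prob; last first.
  by rewrite gt_eqF// sqrtr_gt0 mulr_gt0// subr_gt0.
rewrite sqr_sqrtr ?mulr_ge0// ?(ltW D_gt0)// ?subr_ge0 ?ltW// exprMn e2 mulr1.
rewrite dyadicS => <-; last by move=> x; rewrite lee_fin expR_ge0.
by apply: eq_integral => w _; rewrite dYE mulrA.
Qed.

(** At most one term is nonzero: this is the discount at the exit time of the walk with mesh
    [2 ^- m], or 0 if there is no exit within [N] steps. *)
Let zeta m N w : R :=
  \sum_(i < N) expR (- (th ^+ 2 * v m / 2)) ^+ i.+1 * \1_(first_exit (Y m) b i) w.

Let step_discount m n : expR (- (th ^+ 2 * v m / 2)) ^+ n = expR (- (r * dyadic m n)).
Proof. by rewrite -expRM_natr /dyadic /v; congr expR; field; rewrite expf_neq0. Qed.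

Let mfe m i : measurable (first_exit (Y m) b i).
Proof. exact: measurable_first_exit. Qed.

Let zeta_ge0 m N w : 0 <= zeta m N w.
Proof. by apply: sumr_ge0 => i _; rewrite mulr_ge0// exprn_ge0// expR_ge0. Qed.

Let measurable_zeta m N : measurable_fun setT (zeta m N).
Proof.
by apply: measurable_sum => i; exact: measurable_funM.
Qed.

Let integral_zeta m N :
  (\int[P]_w (zeta m N w)%:E = (discounted_exit (P := P) (Y m) (v m) b th N)%:E)%E.
Proof.
under eq_integral do rewrite -sumEFin.
have m1 i : measurable_fun setT (fun w => (\1_(first_exit (Y m) b i) w)%:E : \bar R).
  exact/measurable_EFinP/measurable_indic.
rewrite ge0_integral_sum//; first last.
- by move=> i; apply/measurable_EFinP; apply: measurable_funM => //; exact/measurable_EFinP.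
rewrite /discounted_exit -sumEFin; apply: eq_bigr => i _.
under eq_integral do rewrite EFinM.
rewrite ge0_integralZl// ?lee_fin ?exprn_ge0 ?expR_ge0//.
by rewrite integral_indic// setIT EFinM fineK// fin_num_measure.
Qed.

Let r_gt0 : 0 < r. Proof. by rewrite divr_gt0// mulr_gt0// exprn_gt0. Qed.

Let zeta_le m N w : zeta m N w <= discount r (sigma w).
Proof.
have [[n nN Hn]|H] := pselect (exists2 n, (n < N)%N & first_exit (Y m) b n w).
  rewrite /zeta (discounted_sum_first_exit _ nN Hn) step_discount.
  have := @crossing_time_le _ _ B e b w m n.+1 Hn.2.
  move=> /(le_discount r_gt0 (crossing_time_ge0 _ _ _ _)).
  by rewrite {1}/discount.
rewrite /zeta discounted_sum_first_exit0 ?discount_ge0// => n nN Hn.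
by apply: H; exists n.
Qed.

Let zeta_ge m k j N w : b < e * B (dyadic m k) w -> (k * 2 ^ j <= N)%N ->
  expR (- (r * dyadic m k)) <= zeta (m + j) N w.
Proof.
move=> bB kN; rewrite -(dyadic_refine m j k).
have bY : b < Y (m + j) (k * 2 ^ j) w by rewrite /Y/= dyadic_refine.
have Y0b : Y (m + j) 0 w <= b by rewrite Y0 ltW.
have [n nk Hn] := first_exit_exists Y0b bY.
rewrite /zeta (discounted_sum_first_exit _ (leq_trans nk kN) Hn) step_discount.
rewrite ler_expR lerN2 ler_pM2l// ler_pM2r ?invr_gt0 ?exprn_gt0//.
by rewrite ler_nat.
Qed.

Lemma measurable_crossing_timeT : measurable_fun setT (fun w => sigma w).
Proof.
apply: (@sub_salgebra_measurable_fun _ _ (\bigcup_t sigma_of (B t))).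
  by move=> A [t _]; exact: sigma_of_sub_measurable.
by apply: measurable_crossing_time => t _ A HA; exists t.
Qed.

Let measurable_discount_sigma :
  measurable_fun setT (fun w => (discount r (sigma w))%:E : \bar R).
Proof.
apply/measurable_EFinP; apply: measurableT_comp; first exact: measurable_discount.
exact: measurable_crossing_timeT.
Qed.

(** The [m * 2 ^ m] steps of mesh [2 ^- m] cover the times up to [m], so a dyadic time with the path
    above [b] is eventually seen by all the walks. The crossing time is the infimum of such
    times. *)
Let discount_le_limn_einf w :
  ((discount r (sigma w))%:E <= limn_einf (fun m => (zeta m (m * 2 ^ m) w)%:E))%E.
Proof.
rewrite limn_einf_lim (cvg_lim _ (@cvg_einfs_sup _ _))//.
set L := ereal_sup _.
have L0 : (0 <= L)%E.
  apply: le_ereal_sup_tmp; exists (einfs (fun m => (zeta m (m * 2 ^ m) w)%:E) 0);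
    first by exists 0%N.
  by apply: le_ereal_inf_tmp => _ [k _ <-]; rewrite lee_fin.
have HL m k : b < e * B (dyadic m k) w -> ((expR (- (r * dyadic m k)))%:E <= L)%E.
  move=> bB; apply: le_ereal_sup_tmp.
  exists (einfs (fun m => (zeta m (m * 2 ^ m) w)%:E) (m + k)); first by exists (m + k)%N.
  apply: le_ereal_inf_tmp => _ [n /= mn <-]; rewrite lee_fin.
  have mn' : (m <= n)%N by apply: leq_trans mn; exact: leq_addr.
  rewrite -[X in zeta X](subnKC mn'); apply: zeta_ge => //.
  apply: leq_mul; first by apply: leq_trans mn; exact: leq_addl.
  by rewrite leq_exp2l// leq_subr.
rewrite /discount; case: ifPn => // sy.
have : (sigma w < +oo)%E by rewrite lt_neqAle sy leey.
have := @crossing_time_ge0 _ _ B e b w.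
case E : (sigma w) sy => [x| |]// _ x0 _ /=; rewrite leNgt; apply/negP => Lx.
have /(@crossing_time_lt _ _ B e b w)[m0 [k0 [/HL L1 _]]] : (sigma w < +oo)%E by rewrite E ltry.
case: L L0 HL Lx L1 => [l| |]// L0 HL; rewrite lte_fin lee_fin => lx l1.
have l0 : 0 < l by apply: lt_le_trans l1; exact: expR_gt0.
(* If [l] were below the discount at the crossing time, some dyadic time before [- ln l / r] would
   already see the path above [b], and its discount would exceed [l]. *)
have : (sigma w < (- ln l / r)%:E)%E.
  rewrite E lte_fin ltr_pdivlMr// ltrNr mulrC -ltr_expR.
  by rewrite lnK.
move=> /(@crossing_time_lt _ _ B e b w)[m [k [/HL]]]; rewrite lee_fin lte_fin => + mk.
apply/negP; rewrite -ltNge -[ltLHS]lnK// ltr_expR ltrNr mulrC.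
by rewrite -ltr_pdivlMr.
Qed.

(** Fatou is enough here; the reverse inequality uses that each [zeta] is dominated by the discount,
    at a single well-chosen mesh. *)
Lemma integral_discount_crossing_le :
  (\int[P]_w (discount r (sigma w))%:E <= (expR (- (th * b)))%:E)%E.
Proof.
apply: (@le_trans _ _ (\int[P]_w limn_einf (fun m => (zeta m (m * 2 ^ m) w)%:E))%E).
  apply: ge0_le_integral_sup => w; first by rewrite lee_fin discount_ge0.
  exact: discount_le_limn_einf.
apply: le_trans.
  apply: fatou => //; first by move=> n; exact/measurable_EFinP.
  by move=> n w _; rewrite lee_fin.
rewrite limn_einf_lim (cvg_lim _ (@cvg_einfs_sup _ _))//.
apply: ge_ereal_sup => _ [n _ <-].
apply: (@le_trans _ _ (\int[P]_w (zeta n (n * 2 ^ n) w)%:E)%E).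
  by apply: ereal_inf_lbound; exists n => //=.
by rewrite integral_zeta lee_fin; apply: discounted_exit_le => //; exact: ltW.
Qed.

Let q : R := fine (\int[P]_w (discount r (sigma w))%:E).

Let qE : (\int[P]_w (discount r (sigma w))%:E = q%:E)%E.
Proof.
rewrite fineK// ge0_fin_numE; last first.
  by apply: integral_ge0 => w _; rewrite lee_fin discount_ge0.
by apply: le_lt_trans integral_discount_crossing_le _; rewrite ltry.
Qed.

Let discounted_exit_le_q m N : discounted_exit (P := P) (Y m) (v m) b th N <= q.
Proof.
rewrite -lee_fin -qE -integral_zeta; apply: ge0_le_integral_sup => w.
  by rewrite lee_fin.
by rewrite lee_fin; exact: zeta_le.
Qed.

Let step_lt1 m : expR (- (th ^+ 2 * v m / 2)) < 1.
Proof. by rewrite -expR0 ltr_expR oppr_lt0 divr_gt0// mulr_gt0// exprn_gt0. Qed.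

Let q_ge_l l eps : 0 < eps -> th <= l ->
  expR (- (th * (b + eps))) <= q + expR (- (l * (b + eps))) +
    expR (- (l * eps)) * (4 * l ^+ 2 / th ^+ 2).
Proof.
move=> eps0 thl; have l0 : 0 < l by exact: lt_le_trans thl.
(* The mesh is chosen after [l]: [m] exceeds [l ^+ 2 * D] and [2 ^+ m] exceeds [m]. *)
pose m := (Num.truncn (l ^+ 2 * D)%R).+1.
have lv : l ^+ 2 * v m <= 1.
  rewrite /v mulrA ler_pdivrMr ?exprn_gt0// mul1r.
  apply: (@le_trans _ _ m%:R); last by rewrite -natrX ler_nat ltnW// ltn_expl.
  by apply: ltW; rewrite truncnS_gt.
apply/ler_addgt0Pr => eta eta0.
have [N dN] := expR_pow_small (x := th ^+ 2 * v m / 2)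
  (ltac:(by rewrite divr_gt0// mulr_gt0// exprn_gt0)) eta0.
have := discounted_exit_ge b_gt0 (Y0 m) (@dY_indep m) (dY_mgf m) N (ltW (v_gt0 m))
  th_gt0 thl (ltW eps0) (step_lt1 m).
have := discounted_exit_le_q m N.
(* The factor 4 is a factor 2 lost in the numerator, by [expR x - 1 <= 2 * x], and another in the
   denominator, by [1 - expR (- x) >= x / 2]. *)
have K : (expR ((l ^+ 2 - th ^+ 2) * v m / 2) - 1) / (1 - expR (- (th ^+ 2 * v m / 2)))
    <= 4 * l ^+ 2 / th ^+ 2.
  have th20 : 0 < th ^+ 2 by rewrite exprn_gt0.
  have thl2 : th ^+ 2 <= l ^+ 2 by rewrite ler_sqr// nnegrE ltW.
  have v0 := v_gt0 m.
  have thv : 0 < th ^+ 2 * v m by rewrite mulr_gt0.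
  have thv1 : th ^+ 2 * v m <= 1 by apply: le_trans lv; rewrite ler_wpM2r// ltW.
  rewrite ler_pdivrMr ?subr_gt0 ?step_lt1//.
  apply: (@le_trans _ _ (2 * ((l ^+ 2 - th ^+ 2) * v m / 2))).
    apply: expR_sub1_le; first by rewrite divr_ge0// mulr_ge0 ?subr_ge0// ltW.
    rewrite ler_pdivrMr// mulVf//; apply: le_trans lv.
    by rewrite ler_wpM2r ?(ltW v0)// gerBl ltW.
  apply: (@le_trans _ _ (4 * l ^+ 2 / th ^+ 2 * ((th ^+ 2 * v m / 2) / 2))).
    have -> : 4 * l ^+ 2 / th ^+ 2 * (th ^+ 2 * v m / 2 / 2) = l ^+ 2 * v m.
      by field; rewrite gt_eqF.
    by rewrite mulrC divfK// ler_wpM2r ?(ltW v0)// gerBl ltW.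
  rewrite ler_wpM2l//; first by rewrite divr_ge0// ?mulr_ge0// ?sqr_ge0// ltW.
  apply: sub1_expRN_ge; first by rewrite divr_ge0// ltW.
  by rewrite ler_pdivrMr// mul1r; apply: le_trans thv1 _; rewrite ler1n.
have e0 : 0 <= expR (- (l * eps)) by exact: expR_ge0.
have := ler_wpM2l e0 K.
by move=> K1 H1 H2; lra.
Qed.

Lemma integral_discount_crossing :
  (\int[P]_w (discount r (sigma w))%:E = (expR (- (th * b)))%:E)%E.
Proof.
apply/eqP; rewrite eq_le integral_discount_crossing_le/= qE lee_fin.
have q_ge eps : 0 < eps -> expR (- (th * (b + eps))) <= q.
  move=> eps0; apply/ler_addgt0Pr => eta eta0.
  (* With [l = j * th] the two errors are at most [1] and [4 * j ^+ 2] times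
     [expR (- (j * (th * eps)))]. *)
  have [j j0 jeta] := expR_beats_square (mulr_gt0 th_gt0 eps0) eta0.
  have j1 : 1 <= j%:R :> R by rewrite ler1n.
  have thl : th <= j%:R * th by rewrite ler_peMl// ltW.
  apply: le_trans (q_ge_l eps0 thl) _; rewrite -addrA lerD2l.
  apply: le_trans jeta; rewrite [leRHS]mulrDr mulr1; apply: lerD.
    rewrite ler_expR lerN2 mulrA ler_wpM2l ?mulr_ge0 ?(ltW th_gt0)//.
    by rewrite lerDr ltW.
  have -> : 4 * (j%:R * th) ^+ 2 / th ^+ 2 = 4 * j%:R ^+ 2.
    by field; rewrite gt_eqF.
  by rewrite -[j%:R * th * eps]mulrA.
rewrite leNgt; apply/negP => qb.
set E := expR (- (th * b)) in qb.
have E0 : 0 < E by exact: expR_gt0.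
(* With this [eps], the bound [E * (1 - th * eps)] is the midpoint of [q] and [E], hence above
   [q]. *)
pose eps := (E - q) / (2 * th * E).
have eps0 : 0 < eps by rewrite divr_gt0 ?subr_gt0// mulr_gt0// mulr_gt0.
have := q_ge _ eps0; rewrite leNgt => /negP; apply.
have -> : expR (- (th * (b + eps))) = E * expR (- (th * eps)).
  by rewrite -expRD; congr expR; ring.
apply: lt_le_trans (_ : E * (1 - th * eps) <= _); last first.
  by rewrite ler_wpM2l ?(ltW E0)// expR_ge1Dx.
rewrite /eps.
have -> : E * (1 - th * ((E - q) / (2 * th * E))) = (E + q) / 2.
  by field; rewrite !gt_eqF.
lra.
Qed.

End brownian_crossing.

(** * Hitting times of the reset process *)

Section crossing_paths.
Context (R : realType) (Omega : Type).
Implicit Types (B : R -> Omega -> R) (e b a : R).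

Lemma crossing_time_hit B e a w (x : \bar R) : e ^+ 2 = 1 -> 0 <= e * a ->
  B 0 w = 0 -> {within `[0, +oo[, continuous (fun t => B t w)} ->
  (crossing_time B e (e * a) w < x)%E ->
  exists u, [/\ 0 <= u, (u%:E < x)%E & B u w = a].
Proof.
move=> e2 ea0 B0 cB /ereal_inf_lt[_ [[m k] /= bB <-] tx].
set t := dyadic m k in bB tx; have t0 : 0 <= t by exact: dyadic_ge0.
have ct : {within `[0, t], continuous (fun s => e * B s w)}.
  apply: (@continuous_subspaceW R^o _ _ [set` `[0, +oo[%R]); first exact: subset_itvl.
  move=> s; apply: (@continuousM R (subspace _)); [exact: cst_continuous|exact: cB].
have [|u] := @IVT R (fun s => e * B s w) 0 t (e * a) t0 ct.
  by rewrite B0 mulr0 minEle maxEle !(ltW (le_lt_trans ea0 bB)) ea0 (ltW bB).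
rewrite in_itv/= => /andP[u0 ut] eBu; exists u; split => //.
  by apply: le_lt_trans tx; rewrite lee_fin.
by rewrite -[LHS]mul1r -e2 expr2 -mulrA eBu mulrA -expr2 e2 mul1r.
Qed.

(** By continuity the path is still above [b] right after [u], where there are dyadic times as close
    to [u] as desired. The strict inequality is why the lower bound needs levels below [|a|]. *)
Lemma crossing_time_le_hit B e b w u : 0 <= u ->
  {within `[0, +oo[, continuous (fun t => B t w)} ->
  b < e * B u w -> (crossing_time B e b w <= u%:E)%E.
Proof.
move=> u0 cB bB.
have cu : (fun t => e * B t w) @ within `[0, +oo[ (nbhs u) --> e * B u w.
  apply: cvgM; first exact: cvg_cst.
  by move/subspace_continuousP : cB; apply; rewrite /= in_itv/= andbT.
have := cu _ (lt_nbhsr bB); rewrite /= withinE => -[V Vu VE].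
have [eta /= eta0 etaV] := Vu.
apply/lee_addgt0Pr => eps eps0.
pose m := (Num.truncn (Num.min eta eps)^-1).+1; pose k := (Num.truncn (u * 2 ^+ m)).+1.
have pm : 0 < 2 ^+ m :> R by rewrite exprn_gt0.
have me0 : 0 < Num.min eta eps by rewrite lt_min eta0.
have mlt : (2 ^+ m)^-1 < Num.min eta eps.
  rewrite invf_plt ?posrE//; apply: (@lt_trans _ _ m%:R); first exact: truncnS_gt.
  by rewrite -natrX ltr_nat ltn_expl.
have uk : u < dyadic m k by rewrite /dyadic ltr_pdivlMr//; exact: truncnS_gt.
have ku : dyadic m k <= u + (2 ^+ m)^-1.
  rewrite /dyadic /k ler_pdivrMr// mulrDl mulVf ?gt_eqF// -natr1 lerD2r.
  by rewrite truncn_le// mulr_ge0// ltW.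
have : V (dyadic m k).
  apply: etaV; rewrite /ball_/= distrC gtr0_norm ?subr_gt0// ltrBlDl.
  by apply: (le_lt_trans ku); rewrite ltrD2l; apply: lt_le_trans mlt _; rewrite ge_min lexx.
move=> Vk; have : (V `&` `[0, +oo[) (dyadic m k).
  by split => //=; rewrite in_itv/= dyadic_ge0.
rewrite -VE => -[/= bBk _]; apply: le_trans (@crossing_time_le _ _ B e b w m k bBk) _.
rewrite -EFinD lee_fin; apply: le_trans ku _; rewrite lerD2l ltW//.
by apply: lt_le_trans mlt _; rewrite ge_min lexx orbT.
Qed.

End crossing_paths.

(** * The reset process along a single path *)

Section reset_paths.
Context d (Omega : measurableType d) (R : realType).
Context (B : nat -> R -> Omega -> R) (T : nat -> Omega -> R) (w : Omega).
Hypothesis T_ge0 : forall n, 0 <= T n w.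
Local Notation S n := (reset_time T n w).

Let S0 : S 0 = 0. Proof. by rewrite /reset_time big_ord0. Qed.

Let SS n : S n.+1 = S n + T n w. Proof. by rewrite /reset_time big_ord_recr. Qed.

Let S_le m n : (m <= n)%N -> S m <= S n.
Proof.
elim: n => [|n IH]; first by rewrite leqn0 => /eqP ->.
rewrite leq_eqVlt => /predU1P[->//|]; rewrite ltnS => /IH; rewrite SS => /le_trans.
by apply; rewrite lerDl.
Qed.

Let S_uniq t n n' : S n <= t < S n.+1 -> S n' <= t < S n'.+1 -> n = n'.
Proof.
wlog : n n' / (n < n')%N => [H Hn Hn'|nn' /andP[_ tn] /andP[n't _]].
  by case: (ltngtP n n') => // nn'; [exact: H|exact/esym/H].
by have := le_lt_trans (le_trans (S_le nn') n't) tn; rewrite ltxx.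
Qed.

Let S_exists N t : 0 <= t < S N -> exists2 n, (n < N)%N & S n <= t < S n.+1.
Proof.
move=> /andP[t0 tN]; have ex : exists n, t < S n by exists N.
case: (ex_minnP ex) => -[|n] tn nmin; first by rewrite S0 ltNge t0 in tn.
exists n; first exact: nmin.
by rewrite tn andbT leNgt; apply/negP => /nmin; rewrite ltnn.
Qed.

Let reset_processE t n : S n <= t < S n.+1 ->
  reset_process B T t w = B n (t - S n) w.
Proof.
move=> tn; rewrite /reset_process.
(* The set contains [n], so [xget] returns one of its members and not the default, and the cycles
   are disjoint. *)
have := @xgetPex _ 0%N [set n | S n <= t < S n.+1] (ex_intro _ n tn).
by move=> /(S_uniq tn) <-.
Qed.

Context (sg : nat -> \bar R) (a : R) (N : nat).
Hypotheses (sg_ge0 : forall n, (0 <= sg n)%E).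
Hypotheses (sgN : (sg N < (T N w)%:E)%E)
  (sg_lt : forall n, (n < N)%N -> ((T n w)%:E <= sg n)%E).

Lemma hitting_time_le :
  (forall x, (sg N < x)%E -> exists u, [/\ 0 <= u, (u%:E < x)%E & B N u w = a]) ->
  (hitting_time (reset_process B T) a w <= (S N)%:E + sg N)%E.
Proof.
move=> hit; move: sgN (sg_ge0 N) hit; case: (sg N) => [s| |]//.
rewrite lte_fin lee_fin => sT s0 hit.
apply/lee_addgt0Pr => eps eps0.
(* The hit must come within [eps] of the crossing and also before the clock that ends cycle [N]. *)
have [|u [u0 us Bu]] := hit (Num.min (s + eps) (T N w))%:E.
  by rewrite lte_fin lt_min ltrDl eps0.
move: us; rewrite lte_fin lt_min => /andP[us uT].
apply: (@le_trans _ _ (S N + u)%:E).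
  apply: ereal_inf_lbound; exists (S N + u) => //; split.
    by rewrite addr_ge0// -[leLHS]S0 S_le.
  by rewrite (@reset_processE _ N) ?SS ?lerDl ?ltrD2l ?u0// addrAC subrr add0r.
by rewrite -!EFinD lee_fin -addrA lerD2l ltW.
Qed.

(** A hit after cycle [N] is late enough, since the crossing in that cycle precedes its clock. A hit
    in an earlier cycle would force a crossing before the clock of that cycle. *)
Lemma hitting_time_ge :
  (forall n u, 0 <= u -> B n u w = a -> (sg n <= u%:E)%E) ->
  ((S N)%:E + sg N <= hitting_time (reset_process B T) a w)%E.
Proof.
move=> hit; apply: le_ereal_inf_tmp => _ [t [t0 Xt] <-].
have SN1 : ((S N)%:E + sg N <= (S N.+1)%:E)%E by rewrite SS EFinD leeD2l// ltW.
have [tN|tN] := leP (S N.+1) t; first by apply: le_trans SN1 _; rewrite lee_fin.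
have [|n nN tn] := @S_exists N.+1 t; first by rewrite t0.
have /andP[nt tn'] := tn.
have u0 : 0 <= t - S n by rewrite subr_ge0.
have := hit n _ u0; rewrite -(reset_processE tn) => /(_ Xt) sgn.
have uT : t - S n < T n w by rewrite ltrBlDl -SS.
have nN' : n = N.
  apply/eqP; rewrite eqn_leq -ltnS nN leqNgt/=; apply/negP => /sg_lt.
  by apply/negP; rewrite -ltNge; apply: le_lt_trans sgn _; rewrite lte_fin.
rewrite -nN'; apply: (@le_trans _ _ ((S n)%:E + (t - S n)%:E)%E); first exact: leeD2l.
by rewrite -EFinD addrC subrK.
Qed.

(** A sum with a random number of cycles is rewritten as a series over all cycles: failed cycles
    contribute their clock, cycle [N] its crossing time, and the indicator kills the later ones.
    Each term is then a past event times a duration of the present cycle. *)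
Lemma sum_mine_clocks :
  (\sum_(n <oo) ((\1_[set n | forall k, (k < n)%N -> ((T k w)%:E <= sg k)%E] n)%:E *
     mine (sg n) (Num.max 0 (T n w))%:E) = (S N)%:E + sg N)%E.
Proof.
rewrite (nneseries_split 0 N.+1); last first.
  by move=> k _; rewrite mule_ge0// le_min sg_ge0 lee_fin le_max lexx.
rewrite [X in (_ + X)%E]eseries0 ?adde0; last first.
  move=> k Nk _; rewrite indicE memNset ?mul0e// => /(_ N Nk).
  by rewrite leNgt sgN.
rewrite add0n big_nat_recr//= indicE mem_set ?mul1e; last by move=> k /sg_lt.
rewrite max_r// min_l ?(ltW sgN)//; congr (_ + _)%E.
rewrite /reset_time -sumEFin big_mkord; apply: eq_bigr => i _.
rewrite indicE mem_set ?mul1e; last by move=> k ki; apply: sg_lt; exact: ltn_trans (ltn_ord i).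
by rewrite max_r// min_r// sg_lt.
Qed.

End reset_paths.

(** * Comparison of integrals outside a null set *)

Section null_sets.
Context d (T : measurableType d) (R : realType) (mu : {measure set T -> \bar R}).
Context (N : set T) (f g : T -> \bar R).
Hypotheses (mN : measurable N) (muN : mu N = 0%E).
Hypotheses (f0 : forall x, (0 <= f x)%E) (g0 : forall x, (0 <= g x)%E).
Hypothesis fg : forall x, ~ N x -> (f x <= g x)%E.

(** Only the upper function is assumed measurable: raising it to [+oo] on the null set keeps its
    integral and makes the inequality hold everywhere. *)
Lemma ge0_le_integral_null :
  measurable_fun setT g -> (\int[mu]_x f x <= \int[mu]_x g x)%E.
Proof.
move=> mg; pose g' x := if x \in N then +oo%E else g x.
have mg' : measurable_fun setT g'.
  apply: measurable_fun_ifT => //; apply: (measurable_fun_bool true).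
  rewrite setTI (_ : _ @^-1` _ = N)//.
  by apply/seteqP; split=> x /=; [move/set_mem|move/mem_set].
have g'0 x : (0 <= g' x)%E by rewrite /g'; case: ifP => // _; rewrite leey.
have -> : (\int[mu]_x g x = \int[mu]_x g' x)%E.
  rewrite (ge0_negligible_integral mN _ mg)// [RHS](ge0_negligible_integral mN _ mg')//.
  by apply: eq_integral => x; rewrite inE => -[_ Nx]; rewrite /g' memNset.
apply: ge0_le_integral_sup => // x; rewrite /g'; case: ifPn => [_|]; first exact: leey.
by rewrite notin_setE; exact: fg.
Qed.

(** Here the lower function is the measurable one, and it is set to 0 on the null set. *)
Lemma ge0_integral_null_le :
  measurable_fun setT f -> (\int[mu]_x f x <= \int[mu]_x g x)%E.
Proof.
move=> mf; rewrite (ge0_negligible_integral mN _ mf)// setTD integral_mkcond.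
apply: ge0_le_integral_sup => x; rewrite patchE; case: ifPn => //.
by rewrite inE; exact: fg.
Qed.

End null_sets.

Lemma hitting_time_ge0 (R : realType) d (Omega : measurableType d)
    (X : R -> Omega -> R) (a : R) (w : Omega) : (0 <= hitting_time X a w)%E.
Proof. by apply: le_ereal_inf_tmp => _ [t [t0 _] <-]; rewrite lee_fin. Qed.

Lemma nneseries_geometric (R : realType) (a z : R) : 0 <= a -> 0 <= z -> z < 1 ->
  (\sum_(n <oo) (a * z ^+ n)%:E = (a / (1 - z))%:E)%E.
Proof.
move=> a0 z0 z1; apply/cvg_lim => //.
have := @cvg_geometric_series R a z; rewrite ger0_norm// => /(_ z1) H.
under eq_fun do rewrite sumEFin.
by apply: cvg_EFin => //; exact: nearW.
Qed.

(** * Renewal over independent cycles *)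

Section renewal.
Context d (Omega : measurableType d) (R : realType) (P : probability Omega R).
Context (D e b th : R) (B : nat -> R -> {RV P >-> R}) (T : nat -> {RV P >-> R}).
Hypotheses (D_gt0 : 0 < D) (e2 : e ^+ 2 = 1) (b_gt0 : 0 < b) (th_gt0 : 0 < th).
Local Notation r := (th ^+ 2 * D / 2).
Hypotheses (B_brownian : forall n, brownian_motion D (B n))
  (T_law : forall n, has_law P (T n) (exponential_prob r)).
Let fam (i : nat + nat) : set (set Omega) :=
  match i with
  | inl n => sigma_of_process (B n)
  | inr n => sigma_of (T n)
  end.
Hypothesis BT_indep : mutually_independent P fam.

Let sg n : Omega -> \bar R := crossing_time (B n) e b.
Let q : R := expR (- (th * b)).
Let cycle (i : nat + nat) := match i with inl n => n | inr n => n end.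

Let r_gt0 : 0 < r. Proof. by rewrite divr_gt0// mulr_gt0// exprn_gt0. Qed.

Let sg_ge0 n w : (0 <= sg n w)%E. Proof. exact: crossing_time_ge0. Qed.

Let fam_measurable i : fam i `<=` measurable.
Proof.
case: i => n /=; last exact: sigma_of_sub_measurable.
apply: smallest_sub; first exact: sigma_algebra_measurable.
by move=> A [t _]; exact: sigma_of_sub_measurable.
Qed.

Let fam_setI i : setI_closed (fam i).
Proof.
case: i => n /=; last exact: sigma_of_setI.
by move=> U V mU mV; exact: (@measurableI _ (g_sigma_algebraType _) U V mU mV).
Qed.

Let fam_setT i : fam i setT.
Proof.
case: i => n /=; last exact: sigma_of_setT.
exact: (@measurableT _ (g_sigma_algebraType _)).
Qed.

Let grouping K1 K2 := @mutually_independent_grouping _ _ _ P _ _ fam_measurable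
  fam_setI fam_setT K1 K2.

Let sub_fam_measurable K : \bigcup_(i in K) fam i `<=` measurable.
Proof. by move=> A [i _]; exact: fam_measurable. Qed.

Let measurable_sg K n : K (inl n) ->
  measurable_fun (setT : set (g_sigma_algebraType (\bigcup_(i in K) fam i))) (sg n).
Proof.
move=> Kn; apply: measurable_crossing_time => t t0 A HA.
exists (inl n) => //=; apply: sub_gen_smallest; exists t => //=.
by rewrite in_itv/= t0.
Qed.

Let measurable_T K n : K (inr n) ->
  measurable_fun (setT : set (g_sigma_algebraType (\bigcup_(i in K) fam i))) (T n).
Proof. by move=> Kn; apply: sigma_of_measurable_fun => A HA; exists (inr n). Qed.

Let msg n : measurable_fun setT (sg n).
Proof.
apply: (@sub_salgebra_measurable_fun _ _ (\bigcup_(i in setT) fam i)).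
  exact: sub_fam_measurable.
exact: measurable_sg.
Qed.

Let sg_T_indep n U V : measurable U -> measurable V ->
  P (sg n @^-1` U `&` T n @^-1` V) = (P (sg n @^-1` U) * P (T n @^-1` V))%E.
Proof.
move=> mU mV; have K : [set inl n] `&` [set inr n] = set0 :> set (nat + nat).
  by apply/seteqP; split => // i [/= ->].
apply: (grouping K BT_indep); apply: salgebra_preimage => //.
- exact: measurable_sg.
- exact: measurable_T.
Qed.

(** Cycle [n] fails: the clock rings no later than the crossing and the search goes on. *)
Let survive n : set Omega := [set w | ((T n w)%:E <= sg n w)%E].
Let alive n : set Omega := [set w | forall k, (k < n)%N -> ((T k w)%:E <= sg k w)%E].
Let duration n w : \bar R := mine (sg n w) (Num.max 0 (T n w))%:E.

Let duration_ge0 n w : (0 <= duration n w)%E.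
Proof. by rewrite le_min sg_ge0 lee_fin le_max lexx. Qed.

Let survive_K K n : K (inl n) -> K (inr n) -> <<s \bigcup_(i in K) fam i >> (survive n).
Proof.
move=> Kl Kr; have := @measurable_lee _ (g_sigma_algebraType (\bigcup_(i in K) fam i)) R setT
  measurableT (EFin \o T n) (sg n).
rewrite setTI; apply; last exact: measurable_sg.
by apply/measurable_EFinP; exact: measurable_T.
Qed.

Let alive_past n : <<s \bigcup_(i in [set i | (cycle i < n)%N]) fam i >> (alive n).
Proof.
rewrite (_ : alive n = \bigcap_(k in `I_n) survive k); last by apply/seteqP; split.
case: n => [|n].
  by rewrite bigcap_mkord big_ord0; exact: (@measurableT _ (g_sigma_algebraType _)).
apply: (@bigcap_measurable _ (g_sigma_algebraType _)); first by exists 0%N.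
by move=> k kn; apply: survive_K.
Qed.

Let measurable_alive n : measurable (alive n).
Proof.
exact: (smallest_sub (@sigma_algebra_measurable _ _) (@sub_fam_measurable _)
  (@alive_past n)).
Qed.

Let measurable_survive n : measurable (survive n).
Proof.
have := @survive_K setT n Logic.I Logic.I.
by move=> /(smallest_sub (@sigma_algebra_measurable _ _) (@sub_fam_measurable _)).
Qed.

Let past_present n : [set i | (cycle i < n)%N] `&` [set i | cycle i = n] = set0.
Proof. by apply/seteqP; split => // i [/= + E]; rewrite E ltnn. Qed.

Let integral_discount n :
  (\int[P]_w (discount r (sg n w))%:E = q%:E)%E.
Proof. exact: integral_discount_crossing. Qed.

(** With the crossing time frozen, the chance that the clock outlasts it is its discount, whose mean
    is [q]. *)
Let P_survive n : P (survive n) = (1 - q)%:E.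
Proof.
suff H : P (~` survive n) = q%:E.
  by rewrite -[survive n]setCK probability_setC ?H//; exact: measurableC.
pose H : set (\bar R * R) := [set z | (z.1 < z.2%:E)%E].
have mH : measurable H.
  have := @measurable_lte _ (\bar R * R)%type R setT measurableT fst (EFin \o snd).
  rewrite setTI; apply; first exact: measurable_fst.
  by apply/measurable_EFinP; exact: measurable_snd.
have mh : measurable_fun setT (fun z : \bar R * R => (\1_H z)%:E : \bar R).
  exact/measurable_EFinP/measurable_indic.
have := ge0_integral_indep (msg n) (measurable_funP (T n)) mh _ (@sg_T_indep n).
move=> /(_ (fun=> ltac:(by rewrite lee_fin))) E.
transitivity (\int[P]_w (\1_H (sg n w, T n w))%:E)%E.
  rewrite -[~` _]setIT -integral_indic//; last exact: measurableC.
  apply: eq_integral => w _; rewrite !indicE; congr (_%:R)%:E; congr nat_of_bool.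
  by apply/idP/idP; rewrite !inE /survive /H /= ltNge => /negP.
rewrite {}E -(integral_discount n); apply: eq_integral => w _.
rewrite -(exponential_clock_gt r_gt0 (@T_law n) (sg_ge0 n w)).
have mS : measurable [set v | (sg n w < (T n v)%:E)%E].
  have := @measurable_lte _ Omega R setT measurableT (cst (sg n w)) (EFin \o T n).
  by rewrite setTI; apply => //; apply/measurable_EFinP.
by rewrite -[X in P X]setIT -integral_indic.
Qed.

Let integral_duration n : (\int[P]_w duration n w = (r^-1 * (1 - q))%:E)%E.
Proof.
pose h (z : \bar R * R) := mine `|z.1|%E (Num.max 0 z.2)%:E.
have mh : measurable_fun setT h.
  apply: measurable_mine; first by apply: measurableT_comp => //; exact: measurable_fst.
  by apply/measurable_EFinP; apply: measurable_maxr => //; exact: measurable_snd.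
have h0 z : (0 <= h z)%E by rewrite le_min abse_ge0 lee_fin le_max lexx.
have := ge0_integral_indep (msg n) (measurable_funP (T n)) mh h0 (@sg_T_indep n).
rewrite /h /=; under eq_integral do rewrite gee0_abs//.
move=> ->.
have r0 : 0 <= r^-1 by rewrite invr_ge0 ltW.
under eq_integral => w _.
  rewrite gee0_abs// (integral_mine_clock r_gt0 (@T_law n))// EFinM.
  over.
have m1 : measurable_fun setT (fun w => (1 - discount r (sg n w))%:E : \bar R).
  apply/measurable_EFinP; apply: measurable_funB => //.
  by apply: measurableT_comp; [exact: measurable_discount|exact: msg].
have m2 : measurable_fun setT (fun w => (discount r (sg n w))%:E : \bar R).
  by apply/measurable_EFinP/measurableT_comp; [exact: measurable_discount|exact: msg].
have d1 w : 0 <= 1 - discount r (sg n w) by rewrite subr_ge0 discount_le1.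
rewrite ge0_integralZl//; last by move=> w _; rewrite lee_fin.
rewrite EFinM; congr (_ * _)%E.
have : (\int[P]_w ((1 - discount r (sg n w))%:E + (discount r (sg n w))%:E) = 1)%E.
  transitivity (\int[P]_w (cst 1%E w : \bar R))%E.
    by apply: eq_integral => w _; rewrite -EFinD subrK.
  by rewrite integral_cst//= probability_setT mul1e.
rewrite ge0_integralD//; first last.
- by move=> w _; rewrite lee_fin discount_ge0.
- by move=> w _; rewrite lee_fin.
by rewrite integral_discount => H; rewrite EFinB -H addeK.
Qed.

Let q_gt0 : 0 < q. Proof. exact: expR_gt0. Qed.

Let q_lt1 : q < 1.
Proof. by rewrite -expR0 ltr_expR oppr_lt0 mulr_gt0. Qed.

Let P_alive n : P (alive n) = ((1 - q) ^+ n)%:E.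
Proof.
elim: n => [|n IH].
  rewrite expr0 (_ : alive 0 = setT) ?probability_setT//.
  by apply/seteqP; split.
rewrite (_ : alive n.+1 = alive n `&` survive n); last first.
  apply/seteqP; split=> w /=.
    by move=> H; split=> [k kn|]; apply: H => //; exact: leqW.
  by move=> [H Hn] k; rewrite ltnS leq_eqVlt => /predU1P[->//|]; exact: H.
rewrite (grouping (past_present n) BT_indep (@alive_past n)) ?IH ?P_survive ?exprSr//.
exact: survive_K.
Qed.

Let measurable_duration K n : K (inl n) -> K (inr n) ->
  measurable_fun (setT : set (g_sigma_algebraType (\bigcup_(i in K) fam i))) (duration n).
Proof.
move=> Kl Kr; apply: measurable_mine; first exact: measurable_sg.
apply/measurable_EFinP; apply: measurable_maxr => //; exact: measurable_T.
Qed.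

Let mduration n : measurable_fun setT (duration n).
Proof.
apply: (@sub_salgebra_measurable_fun _ _ (\bigcup_(i in setT) fam i)).
  exact: sub_fam_measurable.
exact: measurable_duration.
Qed.

Let malive1 n : measurable_fun setT (fun w => (\1_(alive n) w)%:E : \bar R).
Proof. exact/measurable_EFinP/measurable_indic. Qed.

(** [alive n] depends on the cycles before [n] only and [duration n] on cycle [n] only, so the mean
    factors. *)
Let integral_alive_duration n : (\int[P]_w ((\1_(alive n) w)%:E * duration n w) =
  (r^-1 * (1 - q) * (1 - q) ^+ n)%:E)%E.
Proof.
rewrite ge0_integralM_indep//.
- have -> : (\int[P]_w (\1_(alive n) w)%:E = P (alive n))%E.
    by rewrite integral_indic// setIT.
  by rewrite P_alive integral_duration -EFinM mulrC.
- move=> U V mU mV; apply: (grouping (past_present n) BT_indep).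
  + apply: salgebra_preimage => //; apply/measurable_EFinP/measurable_indic.
    exact: alive_past.
  + by apply: salgebra_preimage => //; exact: measurable_duration.
Qed.

Let total_duration w : \bar R :=
  (\sum_(n <oo) ((\1_(alive n) w)%:E * duration n w))%E.

Let total_duration_ge0 w : (0 <= total_duration w)%E.
Proof. by apply: nneseries_ge0 => n _ _; rewrite mule_ge0// lee_fin. Qed.

Let integral_total_duration :
  (\int[P]_w total_duration w = (r^-1 * (q^-1 - 1))%:E)%E.
Proof.
rewrite integral_nneseries//; first last.
- by move=> n w _; rewrite mule_ge0// lee_fin.
- by move=> n; exact: emeasurable_funM.
under eq_eseriesr => n _ do rewrite integral_alive_duration.
rewrite nneseries_geometric//.
- have -> : 1 - (1 - q) = q by ring.
  by congr EFin; rewrite -[LHS]mulrA mulrBl mul1r divff// gt_eqF.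
- by apply: mulr_ge0; rewrite ?invr_ge0 ?subr_ge0 ltW.
- by rewrite subr_ge0 ltW.
- by rewrite gtrBl.
Qed.

(** Outside this event all clocks are nonnegative and some cycle succeeds, which is what the
    pathwise bounds require. *)
Let bad : set Omega := (\bigcap_n alive n) `|` (\bigcup_n [set w | T n w < 0]).

Let measurable_bad : measurable bad.
Proof.
apply: measurableU; first exact: bigcap_measurable.
apply: bigcup_measurable => n _.
rewrite (_ : [set w | _] = T n @^-1` [set` `]-oo, 0[]); last first.
  by apply/seteqP; split=> w /=; rewrite in_itv.
exact: measurable_funPTI.
Qed.

Let P_bad : P bad = 0%E.
Proof.
apply/negligibleP; first exact: measurable_bad.
apply: negligibleU.
  apply/negligibleP; first exact: bigcap_measurable.
  apply/eqP; rewrite eq_le measure_ge0 andbT; apply/lee_addgt0Pr => eps eps0.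
  (* The probability [(1 - q) ^+ n] of [n] failures is at most [expR (- q) ^+ n]. *)
  have [n qn] := expR_pow_small q_gt0 eps0.
  apply: (@le_trans _ _ (P (alive n))).
    apply: le_measure; rewrite ?inE//; first exact: bigcap_measurable.
    exact: bigcap_inf.
  rewrite P_alive add0e lee_fin; apply: le_trans qn.
  by rewrite lerXn2r ?nnegrE ?expR_ge0 ?subr_ge0 ?(ltW q_lt1)// expR_ge1Dx.
apply: negligible_bigcup => n; apply/negligibleP; last exact: exponential_clock_lt0.
rewrite (_ : [set w | _] = T n @^-1` [set` `]-oo, 0[]); last first.
  by apply/seteqP; split=> w /=; rewrite in_itv.
exact: measurable_funPTI.
Qed.

Let good w : ~ bad w -> [/\ forall n, 0 <= T n w &
  exists N, (sg N w < (T N w)%:E)%E /\ forall n, (n < N)%N -> ((T n w)%:E <= sg n w)%E].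
Proof.
move=> wbad; split=> [n|].
  by rewrite leNgt; apply/negP => Tn; apply: wbad; right; exists n.
have ex : exists N, (sg N w < (T N w)%:E)%E.
  apply: contra_notP wbad => H; left => n _ k _.
  by rewrite leNgt; apply/negP => Hk; apply: H; exists k.
case: (ex_minnP ex) => N HN Nmin; exists N; split=> // n nN.
by rewrite leNgt; apply/negP => /Nmin; rewrite leqNgt nN.
Qed.

Let total_durationE w N : (forall n, 0 <= T n w) -> (sg N w < (T N w)%:E)%E ->
  (forall n, (n < N)%N -> ((T n w)%:E <= sg n w)%E) ->
  total_duration w = ((reset_time (fun n => T n) N w)%:E + sg N w)%E.
Proof.
move=> T0 sN sn.
rewrite -(@sum_mine_clocks _ _ _ (fun n => T n) w T0 (sg^~ w) N (sg_ge0^~ w) sN sn).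
by apply: eq_eseriesr => n _; congr (_ * _)%E; rewrite !indicE.
Qed.

Let measurable_total_duration : measurable_fun setT total_duration.
Proof.
apply: ge0_emeasurable_sum => [n w _ _|n _]; last exact: emeasurable_funM.
by rewrite mule_ge0// lee_fin.
Qed.

Local Notation X := (reset_process (fun n t => B n t) (fun n => T n)).

Lemma mean_hitting_time_le a : e * a = b ->
  (mean_hitting_time P X a <= (r^-1 * (expR (th * b) - 1))%:E)%E.
Proof.
move=> ab; rewrite -[expR _]invrK -expRN -integral_total_duration.
apply: (ge0_le_integral_null measurable_bad P_bad) => //.
- exact: hitting_time_ge0.
- move=> w /good[T0 [N [sN sn]]]; rewrite (total_durationE T0 sN sn).
  apply: (@hitting_time_le _ _ _ _ _ _ T0 (sg^~ w)) => // x; rewrite /sg -ab;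
    apply: crossing_time_hit => //.
  + by rewrite ab ltW.
  + exact: (brownian_start (B_brownian N)).
  + exact: (brownian_continuous (B_brownian N)).
Qed.

Lemma mean_hitting_time_ge a : b < e * a ->
  ((r^-1 * (expR (th * b) - 1))%:E <= mean_hitting_time P X a)%E.
Proof.
move=> ab; rewrite -[expR _]invrK -expRN -integral_total_duration.
apply: (ge0_integral_null_le measurable_bad P_bad) => //.
- exact: hitting_time_ge0.
- move=> w /good[T0 [N [sN sn]]]; rewrite (total_durationE T0 sN sn).
  apply: (@hitting_time_ge _ _ _ _ _ _ _ (sg^~ w)) => // n u u0 Bu.
  apply: crossing_time_le_hit => //; last by rewrite Bu.
  exact: (brownian_continuous (B_brownian n)).
Qed.

End renewal.

(** * The mean hitting time and its Gaussian average *)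

Section mean_hitting_time.
Context d (Omega : measurableType d) (R : realType) (P : probability Omega R).
Context (D r : R) (X : R -> Omega -> R).
Hypotheses (D_gt0 : 0 < D) (r_gt0 : 0 < r) (X_reset : poisson_reset_process P D r X).
Local Notation th := (Num.sqrt (2 * r / D)).

Let th_gt0 : 0 < th. Proof. by rewrite sqrtr_gt0 divr_gt0// mulr_gt0. Qed.

Let th2 : th ^+ 2 * D / 2 = r.
Proof. by rewrite sqr_sqrtr ?divr_ge0 ?mulr_ge0 ?ltW//; field; rewrite gt_eqF. Qed.

Lemma mean_hitting_timeE a : a != 0 ->
  mean_hitting_time P X a = (r^-1 * (expR (th * `|a|) - 1))%:E.
Proof.
move=> a0; have [B [T [B_brownian T_law BT_indep XE]]] := X_reset.
have e2 : Num.sg a ^+ 2 = 1 by rewrite sqr_sg a0.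
have ea : Num.sg a * a = `|a| by rewrite -normrEsg.
have na : 0 < `|a| by rewrite normr_gt0.
have T_law' n : has_law P (T n) (exponential_prob (th ^+ 2 * D / 2)) by rewrite th2.
have := mean_hitting_time_le D_gt0 e2 na th_gt0 B_brownian T_law' BT_indep ea.
have : forall b, 0 < b -> b < `|a| ->
    ((r^-1 * (expR (th * b) - 1))%:E <= mean_hitting_time P X a)%E.
  move=> b b0; rewrite -{1}ea => ba; rewrite XE -{1}th2.
  exact: (mean_hitting_time_ge D_gt0 e2 b0 th_gt0 B_brownian T_law' BT_indep ba).
rewrite -XE th2 => ge le; apply/eqP; rewrite eq_le le/=.
have M0 : (0 <= mean_hitting_time P X a)%E.
  by apply: integral_ge0 => w _; exact: hitting_time_ge0.
move: (mean_hitting_time P X a) M0 le ge => [m| |]// _ _ ge.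
have {}ge b : 0 < b -> b < `|a| -> expR (th * b) <= 1 + r * m.
  move=> b0 ba; have := ge b b0 ba.
  by rewrite lee_fin mulrC ler_pdivrMr// lerBlDl [m * r]mulrC.
rewrite lee_fin mulrC ler_pdivrMr// lerBlDl [m * r]mulrC.
set E := expR (th * `|a|); have E0 : 0 < E by exact: expR_gt0.
rewrite leNgt; apply/negP => mE.
set q := 1 + r * m in ge mE.
(* The first bound keeps [E * (1 - th * h)] at or above the midpoint of [q] and [E]; the second
   keeps the level [|a| - h] positive. *)
pose h := Num.min ((E - q) / (2 * th * E)) (`|a| / 2).
have h0 : 0 < h.
  by rewrite lt_min !divr_gt0// ?subr_gt0// mulr_gt0// mulr_gt0.
have ha : h <= `|a| / 2 by rewrite ge_min lexx orbT.
have hE : h <= (E - q) / (2 * th * E) by rewrite ge_min lexx.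
have b0 : 0 < `|a| - h by lra.
have ba : `|a| - h < `|a| by lra.
have := ge _ b0 ba.
apply/negP; rewrite -ltNge.
have -> : expR (th * (`|a| - h)) = E * expR (- (th * h)).
  by rewrite -expRD; congr expR; ring.
apply: lt_le_trans (_ : E * (1 - th * h) <= _); last first.
  by rewrite ler_wpM2l ?(ltW E0)// expR_ge1Dx.
have : th * E * h <= (E - q) / 2.
  apply: le_trans (ler_wpM2l _ hE) _; first by rewrite mulr_ge0// ltW.
  rewrite le_eqVlt; apply/orP; left; apply/eqP; field.
  by rewrite !gt_eqF.
lra.
Qed.

Lemma integral_mean_hitting_time sigma : 0 < sigma ->
  (\int[normal_prob 0 sigma]_a mean_hitting_time P X a =
   (r^-1 * (2 * expR (r * sigma ^+ 2 / D) *
     std_gauss_tail (- (th * sigma)) - 1))%:E)%E.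
Proof.
move=> s0; pose f (a : R) : \bar R := (r^-1 * (expR (th * `|a|) - 1))%:E.
have mf : measurable_fun setT f.
  apply/measurable_EFinP; apply: measurable_funM => //; apply: measurable_funB => //.
  by apply: measurableT_comp => //; exact: measurable_funM.
have f0 a : (0 <= f a)%E.
  by rewrite lee_fin mulr_ge0 ?invr_ge0 ?(ltW r_gt0)// subr_ge0 -[leLHS]expR0 ler_expR.
have M0 a : (0 <= mean_hitting_time P X a)%E.
  by apply: integral_ge0 => w _; exact: hitting_time_ge0.
(* The formula is established for nonzero levels only; the remaining level is a null set. *)
have N0 : normal_prob 0 sigma [set 0] = 0%E by exact: integral_set1.
have fE a : ~ [set 0] a -> mean_hitting_time P X a = f a.
  by move=> /eqP a0; exact: mean_hitting_timeE.
transitivity (\int[normal_prob 0 sigma]_a f a)%E.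
  apply/eqP; rewrite eq_le; apply/andP; split.
    by apply: (ge0_le_integral_null _ N0) => // a /fE ->.
  by apply: (ge0_integral_null_le _ N0) => // a /fE ->.
under eq_integral do rewrite /f EFinM.
rewrite ge0_integralZl//.
- rewrite integral_expR_normr_sub1_normal_prob// ?ltW// -EFinM.
  congr (_ * (2 * expR _ * _ - _))%:E.
  by rewrite sqr_sqrtr ?divr_ge0 ?mulr_ge0 ?ltW//; field; rewrite gt_eqF.
- apply/measurable_EFinP; apply: measurable_funB => //.
  by apply: measurableT_comp => //; exact: measurable_funM.
- by rewrite lee_fin invr_ge0 ltW.
Qed.

End mean_hitting_time.

(** * Numerical minimisation *)

Section taylor_bounds.
Context {R : realType}.
Implicit Types (a b x y : R) (f df : R -> R).

Lemma is_derive_within_continuous f df a b :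
  (forall x, a <= x <= b -> is_derive x 1 f (df x)) ->
  {within `[a, b], continuous f}.
Proof.
move=> f'; apply: derivable_within_continuous => x.
by rewrite in_itv/= => /f' [].
Qed.

Lemma is_derive_ge0_le f df a b : a <= b ->
  (forall x, a <= x <= b -> is_derive x 1 f (df x)) ->
  (forall x, a <= x <= b -> 0 <= df x) -> f a <= f b.
Proof.
move=> ab f' df0; have [||c cab e] := @MVT_segment R f df a b ab.
- by move=> x; rewrite in_itv/= => /andP[/ltW ax /ltW xb]; apply: f'; rewrite ax.
- exact: is_derive_within_continuous f'.
move: cab; rewrite in_itv/= => cab.
by rewrite -subr_ge0 e mulr_ge0 ?df0// subr_ge0.
Qed.

Lemma is_derive_power_sum n (c : nat -> R) (m : nat -> nat) x :
  is_derive x 1 (fun y => \sum_(k < n) c k * y ^+ m k)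
    (\sum_(k < n) c k * ((m k)%:R * x ^+ (m k).-1)).
Proof.
have -> : (fun y => \sum_(k < n) c k * y ^+ m k) =
    \sum_(k < n) (fun y : R => c k * y ^+ m k).
  by apply/funext => y; rewrite fct_sumE.
apply: is_derive_sum => k.
have := is_deriveZ (c k) (@is_deriveX _ _ id (m k) x 1 1 (is_derive_id x 1)).
rewrite /GRing.scale/= mulr1; congr is_derive; apply/funext => y.
by rewrite exprfctE.
Qed.

Lemma divr_factSM n x y : x / (n.+1)`!%:R * (n.+1%:R * y) = x / n`!%:R * y.
Proof.
rewrite factS natrM; have := pnatr_eq0 R n.+1; have := pnatr_eq0 R n`!.
rewrite -[n`! == 0%N]negbK -lt0n fact_gt0.
move: n.+1%:R n`!%:R => a b /negbT b0 /negbT a0.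
by field; rewrite b0.
Qed.

(** The signed remainder with [n.+1] terms vanishes at 0 and its derivative is the signed remainder
    with [n] terms. *)
Lemma expRN_taylor n y : 0 <= y ->
  0 <= (-1) ^+ n * (expR (- y) - \sum_(k < n) (-1) ^+ k / k`!%:R * y ^+ k).
Proof.
elim: n y => [|n IH] y y0; first by rewrite big_ord0 subr0 expr0 mul1r expR_ge0.
pose f (z : R) := (-1) ^+ n.+1 *
  (expR (- z) - \sum_(k < n.+1) (-1) ^+ k / k`!%:R * z ^+ k).
suff : f 0 <= f y.
  rewrite {1}/f big_ord_recl/= big1 => [|k _]; last by rewrite expr0n/= mulr0.
  by rewrite fact0 !expr0 divr1 mulr1 addr0 oppr0 expR0 subrr mulr0.
apply: (@is_derive_ge0_le f (fun z => (-1) ^+ n *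
  (expR (- z) - \sum_(k < n) (-1) ^+ k / k`!%:R * z ^+ k))) => //; last first.
  by move=> x /andP[x0 _]; exact: IH.
move=> x _; have := is_derive_power_sum n.+1 (fun k => (-1) ^+ k / k`!%:R) id x.
move=> dS; apply: is_derive_eq.
rewrite big_ord_recl/= mul0r mulr0 add0r.
rewrite /GRing.scale/= (eq_bigr (fun k : 'I_n => - ((-1) ^+ k / k`!%:R * x ^+ k))).
  by rewrite sumrN exprS; ring.
by move=> k _; rewrite /bump/= add1n divr_factSM exprS !mulN1r !mulNr.
Qed.

(** Starting from [cos y <= 1], integration alternates: a bound on cos gives the one on sin with as
    many terms, which gives the next one on cos. *)
Lemma cos_sin_taylor n y : 0 <= y ->
  0 <= (-1) ^+ n.+1 *
    (cos y - \sum_(k < n.+1) (-1) ^+ k / (k.*2)`!%:R * y ^+ k.*2) /\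
  0 <= (-1) ^+ n.+1 *
    (sin y - \sum_(k < n.+1) (-1) ^+ k / (k.*2.+1)`!%:R * y ^+ k.*2.+1).
Proof.
have dsin m x : is_derive x 1
    (fun z => \sum_(k < m) (-1) ^+ k / (k.*2.+1)`!%:R * z ^+ k.*2.+1)
    (\sum_(k < m) (-1) ^+ k / (k.*2)`!%:R * x ^+ k.*2).
  have := is_derive_power_sum m (fun k => (-1) ^+ k / (k.*2.+1)`!%:R) (fun k => k.*2.+1) x.
  move=> dS; apply: is_derive_eq; apply: eq_bigr => k _ /=.
  by rewrite divr_factSM.
have dcos m x : is_derive x 1
    (fun z => \sum_(k < m.+1) (-1) ^+ k / (k.*2)`!%:R * z ^+ k.*2)
    (- \sum_(k < m) (-1) ^+ k / (k.*2.+1)`!%:R * x ^+ k.*2.+1).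
  have := is_derive_power_sum m.+1 (fun k => (-1) ^+ k / (k.*2)`!%:R) double x.
  move=> dS; apply: is_derive_eq.
  rewrite big_ord_recl/= mul0r mulr0 add0r -sumrN; apply: eq_bigr => k _ /=.
  by rewrite /bump/= add1n doubleS divr_factSM exprS !mulN1r !mulNr.
have sin_of_cos m : (forall z : R, 0 <= z -> 0 <= (-1) ^+ m *
      (cos z - \sum_(k < m) (-1) ^+ k / (k.*2)`!%:R * z ^+ k.*2)) ->
    forall z : R, 0 <= z -> 0 <= (-1) ^+ m *
      (sin z - \sum_(k < m) (-1) ^+ k / (k.*2.+1)`!%:R * z ^+ k.*2.+1).
  move=> H z z0.
  pose f (z : R) := (-1) ^+ m *
      (sin z - \sum_(k < m) (-1) ^+ k / (k.*2.+1)`!%:R * z ^+ k.*2.+1).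
  suff : f 0 <= f z.
    rewrite {1}/f sin0 big1 ?subrr ?mulr0// => k _.
    by rewrite expr0n mulr0.
  apply: (@is_derive_ge0_le f (fun x => (-1) ^+ m *
    (cos x - \sum_(k < m) (-1) ^+ k / (k.*2)`!%:R * x ^+ k.*2)) _ _ z0).
  by move=> x /andP[x0 _]; exact: H.
elim: n y => [|n IH] y y0.
  have H (z : R) : 0 <= z -> 0 <= (-1) ^+ 1 *
      (cos z - \sum_(k < 1) (-1) ^+ k / (k.*2)`!%:R * z ^+ k.*2).
    move=> _; rewrite big_ord_recl big_ord0/= fact0 !expr0 divr1 mulr1 addr0.
    by rewrite expr1 mulN1r oppr_ge0 subr_le0 cos_le1.
  by split; [exact: H|exact: (sin_of_cos 1%N H)].
have H (z : R) : 0 <= z -> 0 <= (-1) ^+ n.+2 *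
    (cos z - \sum_(k < n.+2) (-1) ^+ k / (k.*2)`!%:R * z ^+ k.*2).
  move=> z0; pose f (z : R) := (-1) ^+ n.+2 *
    (cos z - \sum_(k < n.+2) (-1) ^+ k / (k.*2)`!%:R * z ^+ k.*2).
  suff : f 0 <= f z.
    rewrite {1}/f cos0 big_ord_recl big1 => [|k _]; last by rewrite expr0n/= mulr0.
    by rewrite fact0 !expr0 divr1 mulr1 addr0 subrr mulr0.
  pose df (x : R) := (-1) ^+ n.+1 *
    (sin x - \sum_(k < n.+1) (-1) ^+ k / (k.*2.+1)`!%:R * x ^+ k.*2.+1).
  apply: (@is_derive_ge0_le f df _ _ z0) => [x _|x /andP[x0 _]]; last by have [] := IH x x0.
  have := dcos n.+1 x => dS; apply: is_derive_eq.
  by rewrite /GRing.scale/= /df [in LHS]exprS; ring.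
by split; [exact: H|exact: (sin_of_cos _ H)].
Qed.

End taylor_bounds.

(** With an abstract [f], the factorials in the Taylor coefficients unfold into products of small
    numerals in [R]. *)
Lemma natr_fact_rec (R : realType) : exists f : nat -> R,
  [/\ f 0%N = 1, forall n, f n.+1 = n.+1%:R * f n & forall n, n`!%:R = f n].
Proof.
by exists (fun n => n`!%:R); split=> [|n|//]; rewrite ?fact0 // factS natrM.
Qed.

Lemma pi_bounds (R : realType) :
  (3 + 14 / 100 + 15 / (100 * 100) < pi :> R) /\
  (pi < 3 + 14 / 100 + 16 / (100 * 100) :> R).
Proof.
have [f [f0 fS fE]] := natr_fact_rec R.
have pi_lt4 : pi < 4 :> R by have := @pihalf_lt2 R; lra.
have cos_lt (x : R) : 0 <= x -> x <= 2 -> (x < pi / 2) = (0 < cos x).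
  move=> x0 x2; have pi2 := @pi_ge2 R.
  rewrite -[X in X < cos x]cos_pihalf ltr_cos// in_itv/= ?x0/=; lra.
split.
(* Here [x] is 3.1415 / 2; the Taylor sum of degree 10 is a lower bound for cos and still positive
   there. *)
- have [x xE] : exists x : R, x = 157 / 100 + 3 / (40 * 100) by eexists.
  suff : 0 < cos x by rewrite -cos_lt; lra.
  have [|+ _] := @cos_sin_taylor R 5 x; first lra.
  under eq_bigr do rewrite fE.
  rewrite !big_ord_recr big_ord0/= !doubleS double0 !fS f0 xE; lra.
(* Here [x] is 3.1416 / 2, where cos is only about -0.0000037: degree 12 is needed, the upper bound
   of degree 8 being positive. *)
- have [x xE] : exists x : R, x = 157 / 100 + 8 / (100 * 100) by eexists.
  suff : cos x < 0.
    rewrite !ltNge; apply: contra => ple.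
    by apply: cos_ge0_pihalf; apply/andP; split; lra.
  have [|+ _] := @cos_sin_taylor R 6 x; first lra.
  under eq_bigr do rewrite fE.
  rewrite !big_ord_recr big_ord0/= !doubleS double0 !fS f0 xE; lra.
Qed.

(** * The Gaussian distribution function *)

Section half_gaussian.
Context {R : realType}.
Implicit Types x : R.
Local Notation mu := (@lebesgue_measure R).
Local Notation kappa := (Num.sqrt (2 * pi) : R)^-1.

Lemma is_derive_std_gauss_tailN x :
  is_derive x 1 (fun y => std_gauss_tail (- y)) (kappa * expR (- (x ^+ 2 / 2))).
Proof.
pose F (y : R) := (\int[mu]_(t in [set` `]-oo, y]]) normal_pdf 0 1 t)%R.
have mpdf := @measurable_normal_pdf R 0 1.
have ipdf (A : set R) : measurable A -> mu.-integrable A (EFin \o normal_pdf 0 1).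
  move=> mA; apply: (integrableS measurableT) => //.
  exact: integrable_normal_pdf.
have tailE y : std_gauss_tail (- y) = 1 - F (- y).
  have -> : std_gauss_tail (- y) = (\int[mu]_(t in `[(- y)%R, +oo[) normal_pdf 0 1 t)%R.
    by apply: eq_Rintegral => t _; rewrite std_normal_pdfE.
  rewrite -Rintegral_itv_obnd_cbnd; last exact: ipdf.
  rewrite -(@Rintegral_itvB _ _ -oo%O +oo%O) //; last exact: ipdf.
  by rewrite set_itvNyy {1}/Rintegral integral_normal_pdf.
have dF (y : R) : is_derive y 1 F (normal_pdf 0 1 y).
  have [] := @continuous_FTC1 R (normal_pdf 0 1) -oo%O y (y + 1).
  - by rewrite ltrDl.
  - exact: ipdf.
  - by rewrite ltNyr.
  - exact: continuous_normal_pdf.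
  by move=> dF F'; apply: DeriveDef => //; rewrite -derive1E F'.
rewrite (_ : (fun y => _) = (fun y => 1 - F (- y))); last exact/funext.
apply: is_derive_eq.
rewrite normal_pdfE ?oner_eq0// /normal_peak /normal_fun subr0 sqrrN expr1n.
by rewrite mul1r mulrN1 opprK add0r mul1r mulNr !mulr_natl.
Qed.

(** At [c = 0] the Gaussian integral of [expR (c * |x|) - 1] vanishes, and its closed form is twice
    this tail minus 1. *)
Lemma std_gauss_tail0 : std_gauss_tail (0 : R) = 1 / 2.
Proof.
have := @integral_expR_normr_sub1_normal_prob R 0 1 (lexx 0) ltr01.
under eq_integral do rewrite mul0r expR0 subrr.
rewrite integral0 expr0n/= !mul0r expR0 oppr0 => -[]; lra.
Qed.

(** Term by term integration of the bounds for the exponential at [y ^+ 2 / 2]; the constant 1 / 2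
    is the value at 0. *)
Lemma std_gauss_tailN_taylor n x : 0 <= x ->
  0 <= (-1) ^+ n * (std_gauss_tail (- x) - (1 / 2 + kappa *
    \sum_(k < n) (-1) ^+ k / k`!%:R / 2 ^+ k / (k.*2.+1)%:R * x ^+ k.*2.+1)).
Proof.
move=> x0.
pose f (y : R) := (-1) ^+ n * (std_gauss_tail (- y) - (1 / 2 + kappa *
    \sum_(k < n) (-1) ^+ k / k`!%:R / 2 ^+ k / (k.*2.+1)%:R * y ^+ k.*2.+1)).
suff : f 0 <= f x.
  rewrite {1}/f oppr0 std_gauss_tail0 big1 => [|k _]; last by rewrite expr0n mulr0.
  by rewrite mulr0 addr0 subrr mulr0.
pose df (y : R) := (-1) ^+ n * (kappa * (expR (- (y ^+ 2 / 2)) -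
  \sum_(k < n) (-1) ^+ k / k`!%:R * (y ^+ 2 / 2) ^+ k)).
apply: (@is_derive_ge0_le _ f df _ _ x0) => y; last first.
  move=> _; rewrite /df mulrCA mulr_ge0 ?invr_ge0 ?sqrtr_ge0//.
  by apply: expRN_taylor; rewrite divr_ge0 ?sqr_ge0.
move=> _; have dt := is_derive_std_gauss_tailN y.
have dS := is_derive_power_sum n
  (fun k => (-1) ^+ k / k`!%:R / 2 ^+ k / (k.*2.+1)%:R) (fun k => k.*2.+1) y.
apply: is_derive_eq; rewrite /df /GRing.scale/= add0r.
rewrite mul1r -mulrBr; congr (_ * (_ * (_ - _))); apply: eq_bigr => k _.
rewrite mulrA divfK ?pnatr_eq0// -mul2n exprM expr_div_n.
by rewrite [in RHS]mulrA mulrAC.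
Qed.

(** The bounds are 0.39894 and 0.39895. They follow from [kappa ^+ 2 * (2 * pi) = 1] and from pi
    lying between 3.1415 and 3.1416. *)
Lemma kappa_bounds : 2 / 5 - 53 / (500 * 100) < kappa < 2 / 5 - 21 / (200 * 100).
Proof.
have [pi_gt pi_lt] := pi_bounds R.
have k0 : 0 < kappa by rewrite invr_gt0 sqrtr_gt0; lra.
have k2 : kappa ^+ 2 * (2 * pi) = 1.
  rewrite exprVn sqr_sqrtr ?mulVf ?mulf_neq0 ?gt_eqF ?pi_gt0 //; lra.
move: (kappa) k0 k2 => k k0 k2; move: (pi : R) (pi_ge0 R) pi_gt pi_lt k2 => p p0 p_gt p_lt k2.
have sqr_le (a b : R) : 0 <= a -> a <= b -> a ^+ 2 <= b ^+ 2.
  by move=> a0 ab; rewrite !expr2 ler_pM.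
apply/andP; split; rewrite ltNge; apply/negP => hk.
- have hq := sqr_le _ _ (ltW k0) hk.
  have := ler_pM (sqr_ge0 k) p0 hq (ltW p_lt).
  by move: k2; rewrite mulrCA; lra.
- have [c cE] : exists c : R, c = 2 / 5 - 21 / (200 * 100) by eexists.
  have c0 : 0 <= c by lra.
  rewrite -cE in hk; have := ler_pM (sqr_ge0 c) _ (sqr_le _ _ c0 hk) (ltW p_gt).
  by move: k2; rewrite mulrCA cE => k2 /(_ ltac:(lra)); lra.
Qed.

End half_gaussian.

(** * The critical point and the minimal cost *)

Section optimal_rate.
Context {R : realType}.
Implicit Types x y s : R.
Local Notation kappa := (Num.sqrt (2 * pi) : R)^-1.
(* Substituting [s = x^2 / 2], [f x] is the cost to be minimised, [f' x] is its
   derivative and [M x] carries the sign of [f' x]. Since [M'' >= 0], [M 0 = 0] and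
   [M' 0 < 0], [M] has a single zero on [x > 0], close to 0.9913. *)
Local Notation g x := (std_gauss_tail (- x)).
Local Notation e x := (expR (- (x ^+ 2 / 2))).
Local Notation f x := ((2 * expR (x ^+ 2 / 2) * g x - 1) / (x ^+ 2 / 2)).
Local Notation M x := ((x ^+ 2 - 2) * g x + (1 + kappa * x) * e x).
Local Notation f' x := (4 * expR (x ^+ 2 / 2) * M x / x ^+ 3).
Local Notation M' x := (2 * x * g x - (kappa + x) * e x).
Local Notation M'' x := (2 * g x + (3 * kappa * x + x ^+ 2 - 1) * e x).

Lemma kappa_gt0 : 0 < kappa.
Proof. by have /andP[] := @kappa_bounds R; lra. Qed.

Lemma is_derive_half_gaussian x : is_derive x 1 (fun y : R => e y) (- x * e x).
Proof. by apply: is_derive_eq; rewrite /GRing.scale/=; field. Qed.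

Lemma is_derive_critical x : is_derive x 1 (fun y : R => M y) (M' x).
Proof.
have dg := is_derive_std_gauss_tailN x; have de := is_derive_half_gaussian x.
by apply: is_derive_eq; rewrite /GRing.scale/=; ring.
Qed.

Lemma is_derive_critical_deriv x : is_derive x 1 (fun y : R => M' y) (M'' x).
Proof.
have dg := is_derive_std_gauss_tailN x; have de := is_derive_half_gaussian x.
by apply: is_derive_eq; rewrite /GRing.scale/=; ring.
Qed.

Lemma is_derive_cost x : 0 < x ->
  is_derive x 1 (fun y : R => f y) (f' x).
Proof.
move=> x0; have dg := is_derive_std_gauss_tailN x.
have s0 : x ^+ 2 / 2 != 0 by rewrite gt_eqF// divr_gt0// exprn_gt0.
have dV := @is_deriveV R (fun y : R => y ^+ 2 / 2) x _ 1 s0.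
apply: is_derive_eq; rewrite /GRing.scale/=.
rewrite expRN; have := expR_gt0 (x ^+ 2 / 2).
by move: (expR _) (g x) (kappa) => E t k E0; field; rewrite !gt_eqF.
Qed.

Lemma std_gauss_tailN_ge_half x : 0 <= x -> 1 / 2 <= g x.
Proof.
move=> x0; rewrite -[1 / 2]std_gauss_tail0 -{1}oppr0.
apply: (@is_derive_ge0_le R (fun x => g x) (fun x => kappa * e x) 0 x x0) => y _ //=.
exact: is_derive_std_gauss_tailN.
Qed.

(** The only negative part of [M''] is [- e z], and it is absorbed by [2 * g z >= 1 >= e z]. *)
Lemma critical_deriv_nondecreasing x y : 0 <= x -> x <= y -> M' x <= M' y.
Proof.
move=> x0 xy; apply: (@is_derive_ge0_le R (fun x => M' x) (fun x => M'' x) x y xy) => z.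
  by move=> _; exact: is_derive_critical_deriv.
move=> /andP[xz _]; have z0 := le_trans x0 xz.
have := std_gauss_tailN_ge_half z0; have : e z <= 1.
  by rewrite -expR0 ler_expR oppr_le0 divr_ge0 ?sqr_ge0.
have : 0 <= e z * (3 * kappa * z + z ^+ 2).
  by rewrite mulr_ge0 ?expR_ge0// addr_ge0 ?sqr_ge0// !mulr_ge0// ltW.
lra.
Qed.

Lemma critical0 : M 0 = 0.
Proof. by rewrite oppr0 std_gauss_tail0 !expr0n/= mul0r oppr0 expR0 mulr0; lra. Qed.

Lemma critical_mvt x y : x < y -> exists2 z, x < z < y & M y - M x = M' z * (y - x).
Proof.
move=> xy; have [||z zxy ->] := @MVT R (fun x => M x) (fun x => M' x) x y xy.
- by move=> z _; exact: is_derive_critical.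
- by apply: (@is_derive_within_continuous R (fun x => M x) (fun x => M' x)) => z _;
    exact: is_derive_critical.
by exists z; rewrite // in_itv/= in zxy.
Qed.

(** A positive value between the zeros 0 and [x] would force a positive slope before [y] and a
    negative one after it. *)
Lemma critical_le0 x y : M x = 0 -> 0 <= y -> y <= x -> M y <= 0.
Proof.
move=> Mx0; rewrite [0 <= y]le_eqVlt => /predU1P[<- _|y0]; first by rewrite critical0.
rewrite [y <= x]le_eqVlt => /predU1P[-> |yx]; first by rewrite Mx0.
rewrite leNgt; apply/negP => My.
have [a /andP[a0 ay] ae] := critical_mvt y0.
have [b /andP[yb bx] be] := critical_mvt yx.
have := critical_deriv_nondecreasing (ltW a0) (ltW (lt_trans ay yb)); apply/negP; rewrite -ltNge.
have b_lt0 : M' b < 0.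
  by rewrite -(pmulr_llt0 _ (_ : 0 < x - y)) -?be ?Mx0 ?sub0r ?oppr_lt0 ?subr_gt0.
apply: (lt_trans b_lt0).
by rewrite -(pmulr_lgt0 _ (_ : 0 < y - 0)) -?ae ?critical0 ?subr0.
Qed.

(** Some slope vanishes between the zeros 0 and [x], and a negative value beyond [x] would force a
    negative slope later on. *)
Lemma critical_ge0 x y : 0 < x -> M x = 0 -> x <= y -> 0 <= M y.
Proof.
move=> x0 Mx0; rewrite [x <= y]le_eqVlt => /predU1P[<-|xy]; first by rewrite Mx0.
rewrite leNgt; apply/negP => My.
have [a /andP[a0 ax] ae] := critical_mvt x0.
have [b /andP[xb by_] be] := critical_mvt xy.
have := critical_deriv_nondecreasing (ltW a0) (ltW (lt_trans ax xb)); apply/negP; rewrite -ltNge.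
have a_ge0 : M' a = 0.
  by apply/eqP; move: ae; rewrite critical0 Mx0 !subr0 => /esym/eqP;
    rewrite mulf_eq0 (gt_eqF x0) orbF.
by rewrite a_ge0 -(pmulr_llt0 _ (_ : 0 < y - x)) -?be ?Mx0 ?subr0 ?subr_gt0.
Qed.

Lemma cost_min x y : 0 < x -> M x = 0 -> 0 < y -> f x <= f y.
Proof.
move=> x0 Mx0 y0;
have [xy|yx] := leP x y.
  apply: (@is_derive_ge0_le R (fun z => f z) (fun z => f' z) x y xy) => z /andP[xz _].
    by apply: is_derive_cost; exact: lt_le_trans xz.
  have z0 := lt_le_trans x0 xz.
  apply: divr_ge0; last by rewrite exprn_ge0// ltW.
  by apply: mulr_ge0; [rewrite mulr_ge0// expR_ge0|exact: critical_ge0 Mx0 xz].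
rewrite -lerN2; apply: (@is_derive_ge0_le R (fun z => - f z) (fun z => - f' z) y x (ltW yx)) =>
    z /andP[yz zx].
  by apply: is_deriveN; apply: is_derive_cost; exact: lt_le_trans yz.
have z0 := lt_le_trans y0 yz.
rewrite oppr_ge0; apply: mulr_le0_ge0; last by rewrite invr_ge0 exprn_ge0// ltW.
by apply: mulr_ge0_le0; [rewrite mulr_ge0// expR_ge0|exact: critical_le0 Mx0 (ltW z0) zx].
Qed.

(** Since [x ^+ 2 < 2], bounding [M] from above takes [g] from below and [e] from above; the parity
    of the number of Taylor terms, 6 for [g] and 7 for [e], gives these directions. The point is
    0.99125. *)
Lemma critical_left x : x = 99 / 100 + 1 / 800 -> M x <= 0.
Proof.
move=> xE; have x0 : 0 <= x by lra.
have s0 : 0 <= x ^+ 2 / 2 by rewrite divr_ge0 ?sqr_ge0.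
have [h [h0 hS hE]] := natr_fact_rec R.
have e_le : e x <= 61 / 100 + 18 / (100 * 100) + 40 / (100 * 100 * 100).
  have := expRN_taylor 7 s0; under eq_bigr do rewrite hE.
  rewrite !big_ord_recr big_ord0/= !hS h0; move: (e x) => E; rewrite xE; lra.
have g_ge : 1 / 2 + kappa * (85 / 100 + 2 / (100 * 100) + 91 / (100 * 100 * 100)) <= g x.
  suff [S + S_ge] : exists2 S, 1 / 2 + kappa * S <= g x &
      85 / 100 + 2 / (100 * 100) + 91 / (100 * 100 * 100) <= S.
    by apply: le_trans; rewrite lerD2l ler_wpM2l// ltW.
  have := std_gauss_tailN_taylor 6 x0; set S := \sum_(_ < _) _ => H.
  exists S; first by move: H; rewrite -signr_odd/= expr0 mul1r subr_ge0.
  rewrite /S; under eq_bigr do rewrite hE.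
  rewrite !big_ord_recr big_ord0/= !doubleS double0 !hS h0 xE; lra.
have /andP[k_gt k_lt] := @kappa_bounds R.
have := ler_wpM2l (_ : 0 <= 1 + kappa * x) e_le.
move: (e x) (g x) (kappa) g_ge k_gt k_lt => E t k g_ge k_gt k_lt.
by rewrite xE => /(_ ltac:(lra)); lra.
Qed.

(** The directions, [g] from above and [e] from below, serve twice at 0.9914: for the sign of [M]
    and for an upper bound on the cost, in which [expR (x ^+ 2 / 2)] is the inverse of [e x]. *)
Lemma tail_bounds_right x : x = 99 / 100 + 7 / (50 * 100) ->
  [/\ 2 / 5 - 53 / (500 * 100) < kappa, kappa < 2 / 5 - 21 / (200 * 100),
      61 / 100 + 17 / (100 * 100) + 45 / (100 * 100 * 100) <= e x &
      g x <= 1 / 2 + kappa * (85 / 100 + 3 / (100 * 100) + 87 / (100 * 100 * 100))].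
Proof.
move=> xE; have x0 : 0 <= x by lra.
have s0 : 0 <= x ^+ 2 / 2 by rewrite divr_ge0 ?sqr_ge0.
have [h [h0 hS hE]] := natr_fact_rec R.
have /andP[k_gt k_lt] := @kappa_bounds R; split => //.
  have := expRN_taylor 8 s0; under eq_bigr do rewrite hE.
  rewrite !big_ord_recr big_ord0/= !hS h0; move: (e x) => E; rewrite xE; lra.
suff [S + S_le] : exists2 S, g x <= 1 / 2 + kappa * S &
    S <= 85 / 100 + 3 / (100 * 100) + 87 / (100 * 100 * 100).
  by move=> /le_trans; apply; rewrite lerD2l ler_wpM2l// ltW// kappa_gt0.
have := std_gauss_tailN_taylor 7 x0; set S := \sum_(_ < _) _ => H.
exists S; first by move: H; rewrite -signr_odd/= expr1 mulN1r oppr_ge0 subr_le0.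
rewrite /S; under eq_bigr do rewrite hE.
rewrite !big_ord_recr big_ord0/= !doubleS double0 !hS h0 xE; lra.
Qed.

Lemma critical_right x : x = 99 / 100 + 7 / (50 * 100) -> 0 <= M x.
Proof.
move=> xE; have [] := tail_bounds_right xE.
move: (e x) (g x) (kappa) => E t k k_gt k_lt e_ge g_le.
have := ler_wpM2l (_ : 0 <= 1 + k * x) e_ge.
by rewrite xE => /(_ ltac:(lra)); lra.
Qed.

(** Any value of the cost bounds the minimum from above; this point lies close enough to the root
    for the required precision. *)
Lemma cost_right x : x = 99 / 100 + 7 / (50 * 100) -> f x <= 3 + 54 / 100 + 85 / (100 * 100).
Proof.
move=> xE; have [] := tail_bounds_right xE; have := expR_gt0 (x ^+ 2 / 2).
rewrite expRN.
move: (expR _) (g x) (kappa) => E t k E0 k_gt k_lt e_ge g_le.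
rewrite ler_pdivrMr; last by rewrite xE; lra.
have le_e : 2 * t <= (1 + (3 + 54 / 100 + 85 / (100 * 100)) * (x ^+ 2 / 2)) * E^-1.
  by move: E^-1 e_ge => E' e_ge; rewrite xE; lra.
by move: le_e; rewrite ler_pdivlMr//; clear; lra.
Qed.

Lemma sqr_near_root x : 99 / 100 + 1 / 800 <= x -> x <= 99 / 100 + 7 / (50 * 100) ->
  [/\ 0 < x, (99 / 100 + 1 / 800) ^+ 2 <= x ^+ 2 & x ^+ 2 <= (99 / 100 + 7 / (50 * 100)) ^+ 2].
Proof.
have sqr_le (a b : R) : 0 <= a -> a <= b -> a ^+ 2 <= b ^+ 2.
  by move=> a0 ab; rewrite !expr2 ler_pM.
move=> x_ge x_le; have x0 : 0 < x by lra.
split; [exact: x0|apply: (sqr_le _ _ _ x_ge); lra|exact: sqr_le (ltW x0) x_le].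
Qed.

Lemma critical_root : exists2 x, 99 / 100 + 1 / 800 <= x <= 99 / 100 + 7 / (50 * 100) & M x = 0.
Proof.
have [a aE] : exists a : R, a = 99 / 100 + 1 / 800 by eexists.
have [b bE] : exists b : R, b = 99 / 100 + 7 / (50 * 100) by eexists.
have ab : a <= b by lra.
have cM : {within `[a, b], continuous (fun x : R => M x)}.
  apply: (@is_derive_within_continuous R _ (fun x => M' x)) => z _.
  exact: is_derive_critical.
have [|x] := IVT ab cM (v := 0).
  by rewrite ge_min (critical_left aE)/= le_max (critical_right bE) orbT.
by rewrite in_itv/= aE bE; exists x.
Qed.

(** At a root, [M x = 0] eliminates both [g] and the exponential: the cost becomes a rational
    function of [kappa] and [x], for which crude enclosures suffice. *)
Lemma cost_critical x : 99 / 100 + 1 / 800 <= x -> x <= 99 / 100 + 7 / (50 * 100) -> M x = 0 ->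
  3 + 54 / 100 + 75 / (100 * 100) <= f x.
Proof.
move=> x_ge x_le; have [x0 x2_ge x2_le] := sqr_near_root x_ge x_le.
have x2 : 0 < 2 - x ^+ 2 by lra.
move=> Mx.
have -> : f x = (4 * kappa / x + 2) / (2 - x ^+ 2).
  move: Mx; rewrite expRN; have := expR_gt0 (x ^+ 2 / 2).
  move: (expR _) (g x) (kappa) => E t k E0 Mx.
  have -> : t = (1 + k * x) / E / (2 - x ^+ 2).
    by apply: (mulIf (lt0r_neq0 x2)); rewrite divfK ?lt0r_neq0//; clear -Mx; lra.
  by field; rewrite !gt_eqF.
rewrite ler_pdivlMr// -lerBlDr ler_pdivlMr//; clear Mx.
have /andP[k_gt _] := @kappa_bounds R.
(* On the left-hand side, [x ^+ 2] is replaced by its least value; then the remaining [x] is bounded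
   by its largest. *)
apply: le_trans (_ : ((3 + 54 / 100 + 75 / (100 * 100)) *
    (2 - (99 / 100 + 1 / 800) ^+ 2) - 2) * x <= _).
  by rewrite ler_pM2r//; lra.
by move: (kappa) k_gt => k k_gt; lra.
Qed.

(** The tolerances are half a unit in the last digit of 0.491 and 3.548. A root between 0.99125 and
    0.9914 puts [x ^+ 2 / 2] between 0.49128 and 0.49144. *)
Lemma optimal_rate :
  let F s : R := (2 * expR s * std_gauss_tail (- Num.sqrt (2 * s)) - 1) / s in
  exists rho : R, [/\ `|rho - 491 / 1000| <= 1 / 2000, 0 < rho,
    `|F rho - 3548 / 1000| <= 1 / 2000 & forall s, 0 < s -> F rho <= F s].
Proof.
move=> F; have [x /andP[x_ge x_le]] := critical_root.
have [x0 x2_ge x2_le] := sqr_near_root x_ge x_le.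
have x2_near : `|x ^+ 2 / 2 - 491 / 1000| <= 1 / 2000.
  by rewrite ler_norml; apply/andP; split; lra.
move=> Mx.
have FE y : 0 < y -> F (y ^+ 2 / 2) = f y.
  by move=> y0; rewrite /F mulrCA divff// mulr1 sqrtr_sqr gtr0_norm.
exists (x ^+ 2 / 2); split; first exact: x2_near.
- by rewrite divr_gt0// exprn_gt0.
- rewrite FE//; have [b bE] : exists b : R, b = 99 / 100 + 7 / (50 * 100) by eexists.
  have b0 : 0 < b by lra.
  have := cost_critical x_ge x_le Mx.
  have := le_trans (cost_min x0 Mx b0) (cost_right bE).
  move: (f x) => c le_c ge_c; rewrite ler_norml.
  by apply/andP; split; clear -le_c ge_c; lra.
- move=> s s0; have s2 : 0 < Num.sqrt (2 * s) by rewrite sqrtr_gt0 mulr_gt0.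
  have -> : s = Num.sqrt (2 * s) ^+ 2 / 2.
    by rewrite sqr_sqrtr ?mulr_ge0 ?ltW// mulrC mulKf.
  by rewrite !FE// cost_min.
Qed.

End optimal_rate.

Theorem theorem1 (R : realType) (D sigma : R) (D_gt0 : 0 < D)
    (sigma_gt0 : 0 < sigma)
    (d : R -> measure_display) (Omega : forall r : R, measurableType (d r))
    (P : forall r : R, probability (Omega r) R)
    (X : forall r : R, R -> Omega r -> R)
    (X_reset : forall r : R, 0 < r -> poisson_reset_process (P r) D r (X r)) :
  let V (r : R) : \bar R :=
    (\int[normal_prob 0 sigma]_a mean_hitting_time (P r) (X r) a)%E in
  [/\ forall r : R, 0 < r ->
        V r = (r^-1 * (2 * expR (r * sigma ^+ 2 / D) *
                 std_gauss_tail (- (Num.sqrt (2 * r / D) * sigma)) - 1))%:E,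
      forall s : R, 0 < s ->
        V (D / sigma ^+ 2 * s) =
          (sigma ^+ 2 / D *
             ((2 * expR s * std_gauss_tail (- Num.sqrt (2 * s)) - 1) / s))%:E
    & exists c rho : R,
        [/\ `|c - 3548 / 1000| <= 1 / 2000,
            `|rho - 491 / 1000| <= 1 / 2000,
            ereal_inf [set V r | r in [set r : R | 0 < r]] =
              (c * (sigma ^+ 2 / D))%:E
          & V (rho * (D / sigma ^+ 2)) =
              ereal_inf [set V r | r in [set r : R | 0 < r]] ] ].
Proof.
move=> V.
have VE (r : R) : 0 < r -> V r = (r^-1 * (2 * expR (r * sigma ^+ 2 / D) *
    std_gauss_tail (- (Num.sqrt (2 * r / D) * sigma)) - 1))%:E.
  by move=> r0; exact: (integral_mean_hitting_time D_gt0 r0 (X_reset r r0) sigma_gt0).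
have sigma2_gt0 : 0 < sigma ^+ 2 by exact: exprn_gt0.
have VFE (s : R) : 0 < s -> V (D / sigma ^+ 2 * s) = (sigma ^+ 2 / D *
    ((2 * expR s * std_gauss_tail (- Num.sqrt (2 * s)) - 1) / s))%:E.
  move=> s0; rewrite VE ?mulr_gt0 ?invr_gt0//.
  have -> : D / sigma ^+ 2 * s * sigma ^+ 2 / D = s by field; rewrite !gt_eqF.
  have -> : 2 * (D / sigma ^+ 2 * s) / D = 2 * s * (sigma^-1) ^+ 2.
    by field; rewrite !gt_eqF.
  rewrite sqrtrM ?mulr_ge0 ?ltW// sqrtr_sqr gtr0_norm ?invr_gt0// divfK ?gt_eqF//.
  by congr EFin; move: (_ - 1) => n; field; rewrite !gt_eqF.
split=> //.
have [rho [rho_near rho_gt0 c_near rho_min]] := @optimal_rate R.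
have V_rho : V (rho * (D / sigma ^+ 2)) = ereal_inf [set V r | r in [set r : R | 0 < r]].
  apply/eqP; rewrite eq_le; apply/andP; split; last first.
    by apply: ereal_inf_lbound; exists (rho * (D / sigma ^+ 2)); rewrite //= !mulr_gt0 ?invr_gt0.
  apply: le_ereal_inf_tmp => _ [r /= r0 <-].
  (* Brownian scaling: [r * (sigma ^+ 2 / D)] is the dimensionless rate. *)
  have s0 : 0 < r * (sigma ^+ 2 / D) by rewrite mulr_gt0// divr_gt0.
  have -> : r = D / sigma ^+ 2 * (r * (sigma ^+ 2 / D)) by field; rewrite !gt_eqF.
  rewrite [rho * _]mulrC !VFE// lee_fin ler_wpM2l ?rho_min//.
  by rewrite divr_ge0 ?ltW.
exists ((2 * expR rho * std_gauss_tail (- Num.sqrt (2 * rho)) - 1) / rho), rho.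
by split=> //; rewrite -V_rho mulrC VFE// mulrC.
Qed.
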